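(* Let $G\subset GL(V)$ be a nontrivial irreducible finite real reflection group, $n=\dim_{\mathbb C}V$, with degrees $d_1\le\cdots\le d_n$, and let $(g,\zeta,q)$ be an admissible triplet. Let $I^*$ and $I^*_G$ be the bilinear forms defined in the context. Assume that a $g$-homogeneous basis $z^1,\dots,z^n$ of $V^*$ satisfies $$I^*(z^{\alpha},z^{\beta})=\delta_{\alpha+\beta,n+1}\qquad(1\le\alpha,\beta\le n).$$ Let $x^1,\dots,x^n$ be a set of basic invariants that is good with respect to $(g,\zeta,q)$ and compatible with the basis $z^1,\dots,z^n$. Then $x^n(q)\neq 0$ and, for all $\alpha,\beta\in\{1,\dots,n\}$, $I^*_G(dx^\alpha,dx^\beta)$ is expressed through the Taylor coefficients $\frac{\partial^a x^{\gamma}}{\partial z^a}(q)$ ($1\le\gamma\le n$, $a\in\mathbb Z_{\ge0}^n$, $d\cdot a=d_\gamma+d_n$) by $$I^*_G(dx^{\alpha},dx^{\beta})=\delta_{\alpha+\beta,n+1}\frac{x^{n}}{x^{n}(q)}+\sum_{\substack{b=(b_1,\dots,b_n)\in\mathbb Z_{\ge0}^n,\\ b_n=0,\ d\cdot b=d_{\alpha}+d_{\beta}-2}}\frac{1}{b!}\left[\frac{\partial^b}{\partial z^b}\left(\frac{\partial x^{\alpha}}{\partial z^{\beta*}}+\frac{\partial x^{\beta}}{\partial z^{\alpha*}}\right)\right](q)\,x^b,$$ where $\alpha*=n+1-\alpha$ for $1\le\alpha\le n$.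
   Context: Real reflection groups. $V$ is a complex vector space of dimension $n$; $G\subset GL(V)$ is a finite group generated by reflections of order 2 (a reflection is a finite-order element all but one of whose eigenvalues equal 1), there is a $G$-stable real subspace $V_{\mathbb R}\subset V$ with $V_{\mathbb R}\otimes_{\mathbb R}\mathbb C\to V$ bijective, and $V$ is an irreducible $G$-module. $\mathbb C[V]=\mathrm{Sym}(V^* )$ is the algebra of polynomial functions on $V$, with $(g\cdot F)(v)=F(g^{-1}v)$. A set of basic invariants is a set of algebraically independent homogeneous generators $x^1,\dots,x^n$ of $\mathbb C[V]^G$, indexed so that $\deg x^\alpha=d_\alpha$ with $d_1\le\cdots\le d_n$; the degrees depend only on $G$. Known facts: $d_1=2$, $d_{n-1}<d_n$, $d_\alpha+d_{n+1-\alpha}=d_n+2$. Multi-indices. For $b\in\mathbb Z_{\ge0}^n$: $d\cdot b=\sum_i d_ib_i$, $|b|=\sum_i b_i$, $b!=\prod_i b_i!$, $x^b=\prod_i(x^i)^{b_i}$, $z^b=\prod_i(z^i)^{b_i}$, $\frac{\partial^b}{\partial z^b}=\prod_i(\partial/\partial z^i)^{b_i}$. Admissible triplet: $(g,\zeta,q)$ with $g\in G$, $\zeta\in\mathbb C$, $q\in V$, such that (1) $q$ is an eigenvector of $g$ with eigenvalue $\zeta$, a primitive $d_n$-th root of unity; (2) the Jacobian matrix $\left(\frac{\partial x^\alpha}{\partial z^\beta}(q)\right)_{1\le\alpha,\beta\le n}$ is invertible for a basis $z^1,\dots,z^n$ of $V^*$. A $g$-homogeneous basis of $V^*$ is a basis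 with $g\cdot z^\alpha=\zeta^{d_\alpha-1}z^\alpha$ for all $\alpha$ (it exists for an admissible triplet). Maps $\varphi,\psi$. For basic invariants $x^\alpha$ and a $g$-homogeneous basis $z^\alpha$, let $\varphi[g,\zeta,q]:\mathbb C[V]^G\to\mathbb C[V]$ be the $\mathbb C$-linear map $x^a\mapsto\sum_{b}\frac1{b!}\frac{\partial^b([x-x(q)]^a)}{\partial z^b}(q)z^b$, where $[x-x(q)]^a=\prod_i(x^i-x^i(q))^{a_i}$, and let $\psi[g,\zeta,q]:\mathbb C[V]^G\to\mathbb C[V]$ be $x^a\mapsto\sum_{d\cdot b=d\cdot a}\frac1{b!}\frac{\partial^b([x-x(q)]^a)}{\partial z^b}(q)z^b$ (these do not depend on the choice of $x^\alpha$ and $z^\alpha$). Good: basic invariants $x^1,\dots,x^n$ are good with respect to $(g,\zeta,q)$ if they form a $\mathbb C$-basis of $\psi[g,\zeta,q]^{-1}(V^* )$, where $V^*\subset\mathbb C[V]$ is the space of linear forms. Compatible: $x^1,\dots,x^n$ is compatible with the $g$-homogeneous basis $z^1,\dots,z^n$ if $\frac{\partial x^\alpha}{\partial z^\beta}(q)=\delta^\alpha_\beta$ for all $\alpha,\beta$. Bilinear forms. Fix a $G$-invariant positive definite symmetric $\mathbb R$-bilinear form on $V_{\mathbb R}$, extend it $\mathbb C$-bilinearly to $I:V\times V\to\mathbb C$, and let $I^*:V^*\times V^*\to\mathbb C$ be the induced dual form. It extends to $\Omega_{\mathbb C[V]}\otimes_{\mathbb C[V]}\Omega_{\mathbb C[V]}\to\mathbb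 C[V]$ ($\Omega$ = Kähler differentials over $\mathbb C$) and descends to the symmetric $\mathbb C[V]^G$-bilinear form $I^*_G:\Omega_{\mathbb C[V]^G}\otimes_{\mathbb C[V]^G}\Omega_{\mathbb C[V]^G}\to\mathbb C[V]^G$, given by $I^*_G(dx^\alpha,dx^\beta)=\sum_{\gamma_1,\gamma_2}\frac{\partial x^\alpha}{\partial z^{\gamma_1}}\frac{\partial x^\beta}{\partial z^{\gamma_2}}I^*(z^{\gamma_1},z^{\gamma_2})$. *)

(* Defs.v *)
From mathcomp Require Export all_boot all_order all_algebra all_fingroup all_character.
From mathcomp Require Export reals complex.
From mathcomp Require Export mpoly.

Set Implicit Arguments.
Unset Strict Implicit.
Unset Printing Implicit Defensive.

Export Order.TTheory GRing.Theory Num.Theory.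

Local Open Scope ring_scope.
Local Open Scope complex_scope.

(* The complex vector space V is 'rV[R[i]]_n, with a matrix A acting by
   v |-> v *m A, and C[V] is {mpoly R[i][n]}, with 'X_j the j-th coordinate
   function.  The group is the image of a faithful representation rG of G.
   Basic invariants and coordinates are indexed from 0, in dimension n.+1
   whenever a last index is needed: ord_max is the index n of the usual
   notation, and rev_ord a is the index a* = n + 1 - a. *)

Section RealReflectionGroups.
Variables (R : realType) (gT : finGroupType) (G : {group gT}) (n : nat).
Local Notation C := R[i].
Variable rG : mx_representation C G n.

Definition reflection_mx (A : 'M[C]_n) : Prop :=
  exists2 a : C, a != 1 &
    char_poly A = ('X - 1%:P) ^+ n.-1 * ('X - a%:P).

Definition generated_by_order2_reflections : Prop :=
  exists2 S : {set gT},
    (forall s, s \in S -> #[s]%g = 2%N /\ reflection_mx (rG s)) &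
    G :=: <<S>>%g.

(* The last clause is the bijectivity of VR (x)_R C -> V. *)
Definition stable_real_form (VR : 'rV[C]_n -> Prop) : Prop :=
  [/\ forall u v, VR u -> VR v -> VR (u + v),
      forall (c : R) v, VR v -> VR (c%:C *: v),
      forall h v, h \in G -> VR v -> VR (v *m rG h) &
      forall v, exists! uw : 'rV[C]_n * 'rV[C]_n,
        [/\ VR uw.1, VR uw.2 & v = uw.1 + 'i *: uw.2]].

Definition irreducible_real_reflection_group (VR : 'rV[C]_n -> Prop) : Prop :=
  [/\ mx_faithful rG, generated_by_order2_reflections,
      stable_real_form VR & mx_irreducible rG].

(* (h . F)(v) = F (h^-1 v), where the j-th coordinate of h^-1 v is
   \sum_k v_k (rG h^-1)_(k, j). *)
Definition poly_act (h : gT) (F : {mpoly C[n]}) : {mpoly C[n]} :=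
  F \mPo [tuple \sum_(k < n) rG (h^-1)%g k j *: 'X_k | j < n].

Definition poly_invariant (F : {mpoly C[n]}) : Prop :=
  forall h, h \in G -> poly_act h F = F.

Definition is_linear_form (F : {mpoly C[n]}) : Prop := F \is 1.-homog.

Definition C_basis (S : {mpoly C[n]} -> Prop) (y : n.-tuple {mpoly C[n]})
    : Prop :=
  [/\ forall j, S (tnth y j),
      forall c : 'I_n -> C, \sum_j c j *: tnth y j = 0 -> forall j, c j = 0 &
      forall F, S F -> exists c : 'I_n -> C, F = \sum_j c j *: tnth y j].

Definition basic_invariants (d : 'I_n -> nat) (x : n.-tuple {mpoly C[n]})
    : Prop :=
  [/\ forall a, poly_invariant (tnth x a) /\ tnth x a \is (d a).-homog,
      forall p : {mpoly C[n]}, p \mPo x = 0 -> p = 0,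
      forall F, poly_invariant F -> exists p : {mpoly C[n]}, F = p \mPo x &
      forall a b : 'I_n, (a <= b)%N -> (d a <= d b)%N].

(* Row a holds the coefficients of z^a on the coordinate functions 'X_j. *)
Definition coord_mx (z : n.-tuple {mpoly C[n]}) : 'M[C]_n :=
  \matrix_(a, j) (tnth z a)@_U_(j).

(* The coordinate functions 'X_j as linear forms in new variables standing for
   the z^a, so that F \mPo coord_inv z is F written as a polynomial in z. *)
Definition coord_inv (z : n.-tuple {mpoly C[n]}) : n.-tuple {mpoly C[n]} :=
  [tuple \sum_(a < n) invmx (coord_mx z) j a *: 'X_a | j < n].

(* The iterated partial derivative d^b F / d z^b. *)
Definition pderiv (z : n.-tuple {mpoly C[n]}) (b : 'X_{1..n})
    (F : {mpoly C[n]}) : {mpoly C[n]} :=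
  (F \mPo coord_inv z)^`M[b] \mPo z.

Definition jacobian_at (z x : n.-tuple {mpoly C[n]}) (q : 'rV[C]_n)
    : 'M[C]_n :=
  \matrix_(a, b) (pderiv z U_(b) (tnth x a)).@[q 0].

Definition compatible (z x : n.-tuple {mpoly C[n]}) (q : 'rV[C]_n) : Prop :=
  forall a b, (pderiv z U_(b) (tnth x a)).@[q 0] = (a == b)%:R.

Definition homogeneous_basis (d : 'I_n -> nat) (g : gT) (zeta : C)
    (z : n.-tuple {mpoly C[n]}) : Prop :=
  C_basis is_linear_form z /\
  forall a, poly_act g (tnth z a) = zeta ^+ (d a - 1) *: tnth z a.

Definition wdeg (d : 'I_n -> nat) (b : 'X_{1..n}) : nat :=
  (\sum_(j < n) d j * b j)%N.

Definition mfact (b : 'X_{1..n}) : nat := (\prod_(j < n) (b j)`!)%N.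

Definition mpow (y : n.-tuple {mpoly C[n]}) (b : 'X_{1..n}) : {mpoly C[n]} :=
  \prod_(j < n) tnth y j ^+ b j.

(* [x - x(q)]^a *)
Definition shifted_mpow (x : n.-tuple {mpoly C[n]}) (q : 'rV[C]_n)
    (a : 'X_{1..n}) : {mpoly C[n]} :=
  \prod_(j < n) (tnth x j - ((tnth x j).@[q 0])%:MP) ^+ a j.

(* The value of psi at x^a.  The bound on the total degree of b only makes the
   index type finite: d.b = d.a forces |b| <= d.a, as the d_j are positive. *)
Definition psi_mpow (d : 'I_n -> nat) (z x : n.-tuple {mpoly C[n]})
    (q : 'rV[C]_n) (a : 'X_{1..n}) : {mpoly C[n]} :=
  \sum_(b : 'X_{1..n < (wdeg d a).+1} | wdeg d b == wdeg d a)
     ((mfact b)%:R^-1 * (pderiv z b (shifted_mpow x q a)).@[q 0])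
       *: mpow z b.

(* The linear map psi, read on polynomials p in the free generators x: it sends
   the invariant p(x) to psi d z x q p. *)
Definition psi (d : 'I_n -> nat) (z x : n.-tuple {mpoly C[n]})
    (q : 'rV[C]_n) (p : {mpoly C[n]}) : {mpoly C[n]} :=
  \sum_(a <- msupp p) p@_a *: psi_mpow d z x q a.

Definition psi_preim_linear (d : 'I_n -> nat) (z x : n.-tuple {mpoly C[n]})
    (q : 'rV[C]_n) (F : {mpoly C[n]}) : Prop :=
  exists2 p : {mpoly C[n]}, F = p \mPo x & is_linear_form (psi d z x q p).

Definition good (d : 'I_n -> nat) (z x : n.-tuple {mpoly C[n]})
    (q : 'rV[C]_n) : Prop :=
  C_basis (psi_preim_linear d z x q) x.

(* The C-bilinear form on V with Gram matrix I. *)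
Definition bform (I : 'M[C]_n) (u v : 'rV[C]_n) : C := (u *m I *m v^T) 0 0.

(* bform I is the C-bilinear extension of a G-invariant positive definite
   symmetric R-bilinear form on VR; in R[i], 0 < c means that c is real and
   positive. *)
Definition extends_invariant_inner_product (VR : 'rV[C]_n -> Prop)
    (I : 'M[C]_n) : Prop :=
  [/\ forall u v, VR u -> VR v -> exists r : R, bform I u v = r%:C,
      forall u v, VR u -> VR v -> bform I u v = bform I v u,
      forall u, VR u -> u != 0 -> 0 < bform I u u &
      forall h u v, h \in G -> VR u -> VR v ->
        bform I (u *m rG h) (v *m rG h) = bform I u v].

(* The dual form on linear forms: its Gram matrix in the basis 'X_j is the
   inverse of that of bform I in the standard basis of V. *)
Definition dual_bform (I : 'M[C]_n) (F H : {mpoly C[n]}) : C :=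
  \sum_(j < n) \sum_(k < n) F@_U_(j) * H@_U_(k) * invmx I j k.

(* I^*_G (dF, dH) *)
Definition IG_diff (I : 'M[C]_n) (z : n.-tuple {mpoly C[n]})
    (F H : {mpoly C[n]}) : {mpoly C[n]} :=
  \sum_(c1 < n) \sum_(c2 < n)
     dual_bform I (tnth z c1) (tnth z c2)
       *: (pderiv z U_(c1) F * pderiv z U_(c2) H).

End RealReflectionGroups.

Definition admissible_triplet (R : realType) (gT : finGroupType)
    (G : {group gT}) (n : nat) (rG : mx_representation R[i] G n.+1)
    (d : 'I_n.+1 -> nat) (g : gT) (zeta : R[i]) (q : 'rV[R[i]]_n.+1) : Prop :=
  [/\ g \in G, q != 0 /\ q *m rG g = zeta *: q,
      (d ord_max).-primitive_root zeta &
      exists x z : n.+1.-tuple {mpoly R[i][n.+1]},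
        [/\ basic_invariants rG d x, C_basis (@is_linear_form R n.+1) z &
            jacobian_at z x q \in unitmx]].

(* Main.v *)
(** Recentre at q: in the coordinates u = z - z(q), invariance under g and
    g q = zeta q force every monomial u^m of x^a to have weight
    d.m = d_a mod h, where h = d_n.  Goodness and compatibility then give
    x^a = x^a(q) + u_a + (terms of weight >= d_a + h), where x^a(q) = 0 unless
    a = n; here d_{n-1} < d_n because invariant quadratic forms are
    proportional (Schur), and g-invariance of I^* gives d_a + d_{a*} = h + 2.
    Hence I^*_G(dx^a, dx^b) is delta_{a+b,n+1} plus the two single derivatives
    of the statement, up to weight exceeding w = d_a + d_b - 2.  It is also a
    combination of the x^m with d.m = w, so m_n <= 1; the leading part of such
    an x^m is u^m when m_n = 0 and x^n(q) u^{m - e_n}, of weight w - h, when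
    m_n = 1.  Comparing weights w - h and w yields all coefficients. *)
Require Import Defs.
From mathcomp Require Import zify ring.

Set Implicit Arguments.
Unset Strict Implicit.
Unset Printing Implicit Defensive.

Local Open Scope ring_scope.

(** * Substitution, chain rule and Taylor coefficients at the origin *)

Section Composition.
Variable K : fieldType.

Lemma mpoly_ring_ind n (P : {mpoly K[n]} -> Prop) :
  (forall c, P c%:MP) -> (forall i, P 'X_i) ->
  (forall p q, P p -> P q -> P (p + q)) ->
  (forall p q, P p -> P q -> P (p * q)) -> forall p, P p.
Proof.
move=> PC PX PD PM p; rewrite (mpolyE p).
apply: (big_ind P) => [|//|m _]; first by rewrite -mpolyC0.
rewrite -mul_mpolyC; apply: (PM) => //; rewrite mpolyXE_id.
apply: (big_ind P) => [|p1 p2|i _]; first by rewrite -mpolyC1.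
  exact: PM.
elim: (m i) => [|k IH]; first by rewrite expr0 -mpolyC1.
by rewrite exprS; apply: (PM).
Qed.

Lemma comp_mpoly_tnth n k (t : n.-tuple {mpoly K[k]}) i :
  'X_i \mPo t = tnth t i.
Proof. by rewrite comp_mpolyXU (tnth_nth 0). Qed.

Lemma comp_mpolyA n k l (t : n.-tuple {mpoly K[k]}) (s : k.-tuple {mpoly K[l]})
    (p : {mpoly K[n]}) :
  (p \mPo t) \mPo s = p \mPo [tuple tnth t i \mPo s | i < n].
Proof.
elim/mpoly_ring_ind: p => [c|i|p r IHp IHr|p r IHp IHr].
- by rewrite !comp_mpolyC.
- by rewrite !comp_mpoly_tnth tnth_mktuple.
- by rewrite !comp_mpolyD IHp IHr.
- by rewrite !rmorphM /= IHp IHr.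
Qed.

Lemma eq_comp_mpoly n k (t s : n.-tuple {mpoly K[k]}) (p : {mpoly K[n]}) :
  tnth t =1 tnth s -> p \mPo t = p \mPo s.
Proof. by move=> /eq_from_tnth ->. Qed.

Lemma comp_mpoly_idE n (t : n.-tuple {mpoly K[n]}) (p : {mpoly K[n]}) :
  (forall i, tnth t i = 'X_i) -> p \mPo t = p.
Proof.
move=> tE; rewrite -[RHS]comp_mpoly_id; apply: eq_comp_mpoly => i.
by rewrite tE tnth_mktuple.
Qed.

Lemma mderivXU n (i j : 'I_n) : ('X_j : {mpoly K[n]})^`M(i) = (i == j)%:R.
Proof.
rewrite mderivX mnm1E eq_sym; case: eqP => [->|_]; last by rewrite scale0r.
by rewrite -[X in (X - _)%MM]add0m addmK mpolyX0 scale1r.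
Qed.

(** Chain rule: both sides are derivations along [p |-> p \mPo t], so constants and variables
    decide. *)
Lemma mderiv_comp n k (t : n.-tuple {mpoly K[k]}) (p : {mpoly K[n]}) i :
  (p \mPo t)^`M(i) = \sum_j (p^`M(j) \mPo t) * (tnth t j)^`M(i).
Proof.
elim/mpoly_ring_ind: p => [c|j|p r IHp IHr|p r IHp IHr].
- rewrite comp_mpolyC mderivC big1 // => j _.
  by rewrite mderivC comp_mpoly0 mul0r.
- rewrite comp_mpoly_tnth (bigD1 j) //= mderivXU eqxx comp_mpoly1 mul1r.
  rewrite big1 ?addr0 // => l lj.
  by rewrite mderivXU (negbTE lj) comp_mpoly0 mul0r.
- rewrite comp_mpolyD mderivD IHp IHr -big_split /=; apply: eq_bigr => j _.
  by rewrite mderivD comp_mpolyD mulrDl.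
- rewrite rmorphM mderivM IHp IHr mulr_suml mulr_sumr -big_split /=.
  apply: eq_bigr => j _; rewrite mderivM comp_mpolyD !rmorphM /=.
  by rewrite mulrDl mulrAC !mulrA.
Qed.

Lemma multinom_ind n (P : 'X_{1..n} -> Prop) :
  P 0%MM -> (forall i m, P m -> P (U_(i) + m)%MM) -> forall m, P m.
Proof.
move=> P0 PU m.
have [k] := ubnP (mdeg m); elim: k m => // k IH m.
have [->//|m0] := eqVneq m 0%MM.
have [i mi] : exists i, (0 < m i)%N.
  apply/existsP; apply: contraR m0 => /existsPn m0.
  by apply/eqP/mnmP => i; rewrite mnm0E; apply/eqP; rewrite -leqn0 leqNgt m0.
have -> : m = (U_(i) + (m - U_(i)))%MM.
  by apply/mnmP => j; rewrite mnmDE mnmBE mnm1E; case: eqP => [<-|//]; lia.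
move=> lek; apply: (PU); apply: IH; move: lek; rewrite mdegD mdeg1; lia.
Qed.

(* Translations have identity Jacobian. *)
Lemma mderivm_shift n (c : 'I_n -> K) (p : {mpoly K[n]}) b :
  let s := [tuple 'X_i + (c i)%:MP | i < n] in
  (p \mPo s)^`M[b] = p^`M[b] \mPo s.
Proof.
move=> s; elim/multinom_ind: b p => [|i m IH] p; first by rewrite !mderivm0m.
rewrite !mderivmDm !mderivmU1m -IH; congr (_^`M[_]).
rewrite mderiv_comp (bigD1 i) //= big1 ?addr0 => [|j ji].
  by rewrite tnth_mktuple mderivD mderivC mderivXU eqxx addr0 mulr1.
by rewrite tnth_mktuple mderivD mderivC mderivXU eq_sym (negbTE ji) addr0 mulr0.
Qed.

Lemma mcoeff0_meval n (p : {mpoly K[n]}) (v : 'I_n -> K) :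
  v =1 (fun=> 0) -> p.@[v] = p@_0%MM.
Proof.
move=> v0; elim/mpoly_ring_ind: p => [c|i|p r IHp IHr|p r IHp IHr].
- by rewrite mevalC mcoeffC eqxx mulr1.
- by rewrite mevalXU v0 mcoeffX mnm1_eq0.
- by rewrite mevalD IHp IHr mcoeffD.
- by rewrite mevalM IHp IHr rmorphM.
Qed.

Lemma mderivm_mcoeff0 n (p : {mpoly K[n]}) b :
  (p^`M[b])@_0%MM = p@_b *+ mfact b.
Proof.
rewrite mcoeff_mderivm addm0; congr (_ *+ _).
by apply: eq_bigr => i _; rewrite ffactnn.
Qed.

End Composition.

(** * Linear coordinates z and Taylor expansion at q *)

Section Coordinates.
Variables (R : realType) (n : nat).
Local Notation C := R[i].
Implicit Types (F : {mpoly C[n]}) (z : n.-tuple {mpoly C[n]}) (q : 'rV[C]_n).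

Lemma linear_formE F : is_linear_form F -> F = \sum_j F@_U_(j) *: 'X_j.
Proof.
move=> linF; apply/mpolyP => m; rewrite raddf_sum /=.
under eq_bigr => j _ do rewrite mcoeffZ mcoeffX.
have [|m1] := eqVneq (mdeg m) 1%N.
  move=> /eqP/mdeg1P[i /eqP ->]; rewrite (bigD1 i) //= eqxx mulr1.
  rewrite big1 ?addr0 // => j ji; case: eqP => [e|_]; last by rewrite mulr0.
  move/mnmP: e => /(_ i); by rewrite !mnm1E eqxx (negbTE ji).
rewrite (dhomog_nemf_coeff linF m1) big1 // => j _.
case: eqP => [e|_]; last by rewrite mulr0.
by case/negP: m1; rewrite -e mdeg1.
Qed.

Lemma meval_sum (v : 'I_n -> C) (I : Type) (r : seq I) (P : pred I)
    (E : I -> {mpoly C[n]}) :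
  (\sum_(i <- r | P i) E i).@[v] = \sum_(i <- r | P i) (E i).@[v].
Proof. exact: raddf_sum. Qed.

(** The Taylor expansion of F at q: the new variable ['X_a] stands for u_a = z^a - z^a(q), and the
    coefficient at b is 1/b! times d^b F / d z^b at q. *)
Definition recenter z q F : {mpoly C[n]} :=
  F \mPo [tuple \sum_(a < n) invmx (coord_mx z) j a *: 'X_a + (q 0 j)%:MP
         | j < n].

Lemma recenterD z q : {morph recenter z q : F H / F + H}.
Proof. exact: comp_mpolyD. Qed.

Lemma recenterM z q : {morph recenter z q : F H / F * H}.
Proof. exact: rmorphM. Qed.

Lemma meval_recenter z q F : F.@[q 0] = (recenter z q F)@_0%MM.
Proof.
rewrite -(@mcoeff0_meval _ _ (recenter z q F) (fun=> 0)) //.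
rewrite comp_mpoly_meval; apply: meval_eq => i.
rewrite tnth_mktuple mevalD mevalC raddf_sum big1 ?add0r // => a _.
by rewrite /= mevalZ mevalXU mulr0.
Qed.

Variable z : n.-tuple {mpoly C[n]}.
Hypothesis zbasis : C_basis (@is_linear_form R n) z.

Lemma coord_mxE a : tnth z a = \sum_j coord_mx z a j *: 'X_j.
Proof.
have [lin _ _] := zbasis; rewrite [LHS](linear_formE (lin a)).
by apply: eq_bigr => j _; rewrite mxE.
Qed.

(** The z^a span the linear forms, so every coordinate function lies in the row space. *)
Lemma coord_mx_unit : coord_mx z \in unitmx.
Proof.
rewrite -row_full_unit -sub1mx; apply/row_subP => j.
have [_ _ /(_ 'X_j)[|c cE]] := zbasis; first by rewrite /is_linear_form dhomogX /= mdeg1.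
apply/submxP; exists (\row_a c a); apply/rowP => l; rewrite !mxE.
have := congr1 (mcoeff U_(l)%MM) cE; rewrite mcoeffX raddf_sum /= => e.
transitivity ((U_(j)%MM == U_(l)%MM :> 'X_{1..n})%:R : C).
  have [->|jl] := eqVneq j l; first by rewrite eqxx.
  case: eqP => // /mnmP/(_ l); rewrite !mnm1E eqxx.
  by rewrite (negbTE jl).
by rewrite e; apply: eq_bigr => a _; rewrite mcoeffZ !mxE.
Qed.

Lemma mul_coord_mxV i j :
  \sum_a coord_mx z i a * invmx (coord_mx z) a j = (i == j)%:R.
Proof. by have /matrixP/(_ i j) := mulmxV coord_mx_unit; rewrite !mxE. Qed.

Lemma mul_Vcoord_mx i j :
  \sum_a invmx (coord_mx z) i a * coord_mx z a j = (i == j)%:R.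
Proof. by have /matrixP/(_ i j) := mulVmx coord_mx_unit; rewrite !mxE. Qed.

Lemma sum_delta_scale (V : lmodType C) (F : 'I_n -> V) i :
  \sum_j (i == j)%:R *: F j = F i.
Proof.
rewrite (bigD1 i) //= eqxx scale1r big1 ?addr0 // => j ji.
by rewrite eq_sym (negbTE ji) scale0r.
Qed.

Lemma coord_comp_inv a : tnth z a \mPo coord_inv z = 'X_a.
Proof.
rewrite coord_mxE raddf_sum /=.
under eq_bigr => j _ do rewrite comp_mpolyZ comp_mpoly_tnth tnth_mktuple scaler_sumr.
rewrite exchange_big -[RHS](sum_delta_scale (fun b => 'X_b)) /=.
apply: eq_bigr => b _; under eq_bigr => j _ do rewrite scalerA.
by rewrite -scaler_suml mul_coord_mxV.
Qed.

Lemma coord_inv_comp j : tnth (coord_inv z) j \mPo z = 'X_j.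
Proof.
rewrite tnth_mktuple raddf_sum /=.
under eq_bigr => a _ do rewrite comp_mpolyZ comp_mpoly_tnth coord_mxE scaler_sumr.
rewrite exchange_big -[RHS](sum_delta_scale (fun b => 'X_b)) /=.
apply: eq_bigr => b _; under eq_bigr => a _ do rewrite scalerA.
by rewrite -scaler_suml mul_Vcoord_mx.
Qed.

Lemma recenter_coord q a :
  recenter z q (tnth z a) = 'X_a + ((tnth z a).@[q 0])%:MP.
Proof.
rewrite {1}coord_mxE /recenter raddf_sum /=.
under eq_bigr => j _ do rewrite comp_mpolyZ comp_mpoly_tnth tnth_mktuple scalerDr scaler_sumr.
rewrite big_split /= exchange_big /=; congr (_ + _).
  rewrite -[RHS](sum_delta_scale (fun b => 'X_b)) /=.
  apply: eq_bigr => b _; under eq_bigr => j _ do rewrite scalerA.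
  by rewrite -scaler_suml mul_coord_mxV.
rewrite coord_mxE meval_sum raddf_sum /=; apply: eq_bigr => j _.
by rewrite mevalZ mevalXU mpolyCM mul_mpolyC.
Qed.

Lemma comp_inv_coord F : (F \mPo coord_inv z) \mPo z = F.
Proof.
rewrite comp_mpolyA; apply: comp_mpoly_idE => i.
by rewrite tnth_mktuple coord_inv_comp.
Qed.

Lemma comp_coord_inv F : (F \mPo z) \mPo coord_inv z = F.
Proof.
rewrite comp_mpolyA; apply: comp_mpoly_idE => i.
by rewrite tnth_mktuple coord_comp_inv.
Qed.

Lemma recenter_comp_coord q F :
  recenter z q (F \mPo z) =
  F \mPo [tuple 'X_a + ((tnth z a).@[q 0])%:MP | a < n].
Proof.
rewrite /recenter comp_mpolyA; apply: eq_comp_mpoly => a.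
by rewrite !tnth_mktuple; apply: recenter_coord.
Qed.

(** Written in the coordinates z, recentring is a translation, and translations commute with partial
    derivatives. *)
Lemma recenter_pderiv q b F :
  recenter z q (pderiv z b F) = (recenter z q F)^`M[b].
Proof.
by rewrite recenter_comp_coord -mderivm_shift -recenter_comp_coord comp_inv_coord.
Qed.

Lemma meval_pderiv q b F :
  (pderiv z b F).@[q 0] = (recenter z q F)@_b *+ mfact b.
Proof. by rewrite (meval_recenter z) recenter_pderiv mderivm_mcoeff0. Qed.

Lemma pderiv_add b1 b2 F :
  pderiv z b1 (pderiv z b2 F) = pderiv z (b1 + b2)%MM F.
Proof. by rewrite /pderiv comp_coord_inv addmC mderivmDm. Qed.

Lemma pderivU a F :
  pderiv z U_(a) F = \sum_j invmx (coord_mx z) j a *: F^`M(j).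
Proof.
rewrite /pderiv mderivmU1m mderiv_comp raddf_sum /=; apply: eq_bigr => j _.
rewrite rmorphM /= comp_inv_coord -mul_mpolyC mulrC; congr (_ * _).
have -> : (tnth (coord_inv z) j)^`M(a) = (invmx (coord_mx z) j a)%:MP.
  rewrite tnth_mktuple (raddf_sum (mderiv a)) (bigD1 a) //= big1 => [|b ba].
    by rewrite mderivZ mderivXU eqxx addr0 -mul_mpolyC mulr1.
  by rewrite mderivZ mderivXU eq_sym (negbTE ba) scaler0.
exact: comp_mpolyC.
Qed.

Lemma mderiv_pderivU j F :
  F^`M(j) = \sum_a coord_mx z a j *: pderiv z U_(a) F.
Proof.
under eq_bigr => a _ do rewrite pderivU scaler_sumr.
rewrite exchange_big -[LHS](sum_delta_scale (fun i => F^`M(i))) /=.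
apply: eq_bigr => i _; under eq_bigr => a _ do rewrite scalerA mulrC.
by rewrite -scaler_suml mul_Vcoord_mx eq_sym.
Qed.

(** Euler's identity is checked monomial by monomial in the standard coordinates and then
    transported to z. It will link x^n(q) with z^n(q). *)
Lemma euler_pderiv k F q : F \is k.-homog ->
  k%:R * F.@[q 0] = \sum_a (tnth z a).@[q 0] * (pderiv z U_(a) F).@[q 0].
Proof.
move=> homF; have Euler : k%:R *: F = \sum_j 'X_j * F^`M(j).
  apply/mpolyP => m; rewrite mcoeffZ raddf_sum /=.
  have coefE j : ('X_j * F^`M(j))@_m = F@_m *+ m j.
    have [/eqP mj0|mj0] := boolP (m j == 0)%N.
      rewrite mj0 mulr0n; apply: contraTeq isT => /=.
      rewrite -mcoeff_msupp mulrC (perm_mem (msuppMX _ _)) => /mapP[m' _ me].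
      by move: mj0; rewrite me mnmDE mnm1E eqxx; lia.
    have mE : m = ((m - U_(j)) + U_(j))%MM.
      by apply/mnmP => i; rewrite mnmDE mnmBE mnm1E; case: eqP => [<-|//]; lia.
    rewrite [in LHS]mE addmC mulrC mcoeffMX mcoeff_mderiv -mE mnmBE mnm1E eqxx.
    by rewrite subn1 prednK // lt0n.
  under eq_bigr => j _ do rewrite coefE.
  rewrite sumrMnr; have [->|Fm0] := eqVneq (F@_m) 0; first by rewrite mulr0 mul0rn.
  have <- : mdeg m = k.
    by apply: (dhomog_mf homF); rewrite mcoeff_msupp.
  by rewrite mdegE mulr_natl.
rewrite -mevalZ Euler meval_sum.
under eq_bigr => j _ do rewrite mderiv_pderivU mevalM mevalXU meval_sum mulr_sumr.
rewrite exchange_big /=; apply: eq_bigr => a _.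
rewrite coord_mxE meval_sum mulr_suml; apply: eq_bigr => j _ /=.
by rewrite !mevalZ mevalXU mulrA [q _ _ * _]mulrC.
Qed.

End Coordinates.

(** * The filtration of polynomials by weight, u_j having weight d_j *)

Section WeightFiltration.
Variables (K : fieldType) (n : nat) (d : 'I_n -> nat).
Implicit Types (F H : {mpoly K[n]}) (m : 'X_{1..n}).

Lemma wdegD m1 m2 : wdeg d (m1 + m2)%MM = (wdeg d m1 + wdeg d m2)%N.
Proof.
by rewrite /wdeg -big_split; apply: eq_bigr => j _; rewrite mnmDE mulnDr.
Qed.

Lemma wdeg0 : wdeg d 0%MM = 0%N.
Proof. by rewrite /wdeg big1 // => j _; rewrite mnm0E muln0. Qed.

Lemma wdegU j : wdeg d U_(j)%MM = d j.
Proof.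
rewrite /wdeg (bigD1 j) //= mnm1E eqxx muln1 big1 ?addn0 // => i ij.
by rewrite mnm1E eq_sym (negbTE ij) muln0.
Qed.

Lemma wdeg_ge_mul m j : (d j * m j <= wdeg d m)%N.
Proof. by rewrite /wdeg (bigD1 j) //= leq_addr. Qed.

Lemma wdeg_eq0 m : (forall j, 0 < d j)%N -> wdeg d m = 0%N -> m = 0%MM.
Proof.
move=> d_gt0 m0; apply/mnmP => j; rewrite mnm0E.
by have := wdeg_ge_mul m j; rewrite m0 leqn0 muln_eq0 gtn_eqF //= => /eqP.
Qed.

Lemma mdeg_le_wdeg m : (forall j, 0 < d j)%N -> (mdeg m <= wdeg d m)%N.
Proof.
move=> d_gt0; rewrite mdegE; apply: leq_sum => j _.
by rewrite leq_pmull.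
Qed.

Definition weight_ge (t : nat) F := forall b, (wdeg d b < t)%N -> F@_b = 0.

Lemma weight_ge0 t : weight_ge t 0.
Proof. by move=> m _; rewrite mcoeff0. Qed.

Lemma weight_geW s t F : (s <= t)%N -> weight_ge t F -> weight_ge s F.
Proof. by move=> st Ft m ms; apply: Ft; apply: leq_trans ms st. Qed.

Lemma weight_geD t F H : weight_ge t F -> weight_ge t H -> weight_ge t (F + H).
Proof. by move=> Ft Ht m mt; rewrite mcoeffD Ft ?Ht ?addr0. Qed.

Lemma weight_geZ t c F : weight_ge t F -> weight_ge t (c *: F).
Proof. by move=> Ft m mt; rewrite mcoeffZ Ft ?mulr0. Qed.

Lemma weight_ge_sum t (I : finType) (P : pred I) (F : I -> {mpoly K[n]}) :
  (forall i, P i -> weight_ge t (F i)) -> weight_ge t (\sum_(i | P i) F i).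
Proof. by move=> Ft m mt; rewrite raddf_sum big1 // => i Pi; apply: Ft. Qed.

Lemma weight_geM s t F H :
  weight_ge s F -> weight_ge t H -> weight_ge (s + t) (F * H).
Proof.
move=> Fs Ht m mst; rewrite mcoeffM big1 // => -[k1 k2] /= /eqP mE.
have st : (wdeg d k1 + wdeg d k2 < s + t)%N by rewrite -wdegD -mE.
have [lt1|ge1] := ltnP (wdeg d k1) s; first by rewrite Fs // mul0r.
by rewrite Ht ?mulr0 //; lia.
Qed.

Lemma weight_geX m : weight_ge (wdeg d m) 'X_[m].
Proof. by move=> m1 lt1; rewrite mcoeffX; case: eqP => // e; move: lt1; rewrite e ltnn. Qed.

(** The subtraction is truncated; when t <= d_j the conclusion is empty. *)
Lemma weight_ge_mderiv t F j : weight_ge t F -> weight_ge (t - d j) F^`M(j).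
Proof.
move=> Ft m mt; rewrite mcoeff_mderiv Ft ?mul0rn // wdegD wdegU; lia.
Qed.

(** A gap h between leading term and error survives products, by FH - F'H' = (F - F')H + F'(H -
    H'). *)
Lemma weight_ge_mpow h (y : 'I_n -> {mpoly K[n]}) m :
  (forall j, weight_ge (d j + h) (y j - 'X_j)) ->
  weight_ge (wdeg d m + h) (\prod_j y j ^+ m j - 'X_[m]).
Proof.
move=> yX; rewrite mpolyXE_id.
have step s t F F' H H' : weight_ge s F' -> weight_ge t H' ->
    weight_ge (s + h) (F - F') -> weight_ge (t + h) (H - H') ->
    weight_ge (s + t + h) (F * H - F' * H') /\ weight_ge (s + t) (F' * H').
  move=> F's H't FF' HH'; split; last exact: weight_geM.
  have Ht : weight_ge t H.
    by rewrite -(subrK H' H); apply: weight_geD => //; apply: weight_geW HH'; lia.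
  have -> : F * H - F' * H' = (F - F') * H + F' * (H - H') by ring.
  apply: weight_geD.
    by rewrite addnAC; apply: weight_geM.
  by rewrite -addnA; apply: weight_geM.
have pow j k : weight_ge (d j * k + h) (y j ^+ k - 'X_j ^+ k)
    /\ weight_ge (d j * k) ('X_j ^+ k).
  elim: k => [|k [IH1 IH2]].
    by rewrite !expr0 subrr muln0; split; [exact: weight_ge0|].
  rewrite mulnS !exprS; apply: step => //.
  by rewrite -(wdegU j); apply: weight_geX.
suff /(_ (index_enum _))[] : forall r : seq 'I_n,
    weight_ge (\sum_(j <- r) d j * m j + h)
      (\prod_(j <- r) y j ^+ m j - \prod_(j <- r) 'X_j ^+ m j)
    /\ weight_ge (\sum_(j <- r) d j * m j) (\prod_(j <- r) 'X_j ^+ m j) by [].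
elim=> [|j r [IH1 IH2]].
  by rewrite !big_nil subrr; split; [exact: weight_ge0|].
by rewrite !big_cons; have [pow1 pow2] := pow j (m j); apply: step.
Qed.

End WeightFiltration.

(** * Recovering a weighted homogeneous P from the lowest weights of P(y) *)

Section Comparison.
Variables (K : fieldType) (n : nat) (d : 'I_n.+1 -> nat).
Hypothesis d_gt0 : forall j, (0 < d j)%N.
Let h := d ord_max.
Variables (k : K) (y : n.+1.-tuple {mpoly K[n.+1]}).
Hypothesis k_neq0 : k != 0.
Hypothesis yE : forall j,
  weight_ge d (d j + h) (tnth y j - (k *+ (j == ord_max))%:MP - 'X_j).

(** The generators stripped of their constant terms; only the last one has such a term, namely
    [k]. *)
Let Y j := tnth y j - (k *+ (j == ord_max))%:MP.

(** Without the last generator no constant term enters, so the leading part is the monomial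
    itself. *)
Lemma mpow_no_max (m : 'X_{1..n.+1}) : m ord_max = 0%N ->
  weight_ge d (wdeg d m + h) ('X_[m] \mPo y - 'X_[m]).
Proof.
move=> m0; have -> : 'X_[m] \mPo y = \prod_j Y j ^+ m j.
  rewrite comp_mpolyX; apply: eq_bigr => j _; rewrite /Y.
  by case: eqP => [->|_]; rewrite ?m0 ?expr0 // mulr0n mpolyC0 subr0.
exact: weight_ge_mpow.
Qed.

(** One factor y_n contributes its constant [k] to the leading part, which lowers the leading weight
    by h. *)
Lemma mpow_one_max (m : 'X_{1..n.+1}) : m ord_max = 0%N ->
  weight_ge d (wdeg d m + h)
    ('X_[(U_(ord_max) + m)] \mPo y - k *: 'X_[m]).
Proof.
move=> m0; rewrite mpolyXD rmorphM /= comp_mpoly_tnth.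
have -> : tnth y ord_max = Y ord_max + k%:MP by rewrite /Y eqxx subrK.
rewrite mulrDl mul_mpolyC -addrA -scalerBr; apply: weight_geD.
  rewrite addnC; apply: weight_geM.
    rewrite -(subrK 'X_ord_max (Y _)); apply: weight_geD.
      by apply: (weight_geW (leq_addl _ _) (@yE _)).
    by have := @weight_geX K _ d U_(ord_max); rewrite wdegU.
  rewrite -(subrK 'X_[m] (_ \mPo _)); apply: weight_geD.
    by apply: (weight_geW (leq_addr _ _) (mpow_no_max m0)).
  exact: weight_geX.
by apply: weight_geZ; apply: mpow_no_max.
Qed.

Variables (w : nat) (P G : {mpoly K[n.+1]}) (delta : K).
Hypothesis w_gt0 : (0 < w)%N.
Hypothesis w_lt : (w < h + h)%N.
Hypothesis Pw : forall m, m \in msupp P -> wdeg d m = w.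
Hypothesis Gw : weight_ge d w G.
Hypothesis delta_w : delta != 0 -> w = h.
Hypothesis PyE : P \mPo y = delta%:MP + G.

(** Since w < 2h, the last exponent is at most 1. *)
Lemma max_split (m : 'X_{1..n.+1}) : wdeg d m = w -> (0 < m ord_max)%N ->
  exists2 m', m = (U_(ord_max) + m')%MM & m' ord_max = 0%N /\ (wdeg d m' + h = w)%N.
Proof.
move=> mw m_gt0; exists (m - U_(ord_max))%MM.
  apply/mnmP => j; rewrite mnmDE mnmBE mnm1E.
  by case: eqP => [<-|_]; [rewrite subnKC | rewrite subn0].
have mE : m = (m - U_(ord_max) + U_(ord_max))%MM.
  apply/mnmP => j; rewrite mnmDE mnmBE mnm1E.
  by case: eqP => [<-|_]; [rewrite subnK | rewrite subn0 addn0].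
split; last by rewrite -mw [in RHS]mE wdegD wdegU.
rewrite mnmBE mnm1E eqxx.
have := wdeg_ge_mul d m ord_max; rewrite mw -/h => le.
case E : (m ord_max) le m_gt0 => [|[|e]] // le _.
by move: (leq_ltn_trans le w_lt); rewrite mulnS mulnS; lia.
Qed.

Lemma coef_comp m0 :
  (P \mPo y)@_m0 = \sum_(m <- msupp P) P@_m * ('X_[m] \mPo y)@_m0.
Proof.
rewrite comp_mpolyEX raddf_sum /=; apply: eq_bigr => m _.
by rewrite mcoeffZ.
Qed.

(** Compare coefficients at m' = m - e_n, of weight w - h. Products without y_n start at weight w,
    and those with y_n have leading part [k] times their own m', so P(y) has coefficient k P_m
    there. As G starts at weight w, the other side contributes only [delta], at m' = 0. *)
Lemma coef_with_max (m : 'X_{1..n.+1}) : wdeg d m = w -> (0 < m ord_max)%N ->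
  P@_m = delta / k * (m == U_(ord_max)%MM)%:R.
Proof.
move=> mw m_gt0; have [m' mE [m'0 m'w]] := max_split mw m_gt0.
have h_gt0 : (0 < h)%N by exact: d_gt0.
have coefE : (P \mPo y)@_m' = k * P@_m.
  rewrite coef_comp; have supp1 m1 : m1 \in msupp P -> m1 != m ->
      P@_m1 * ('X_[m1] \mPo y)@_m' = 0.
    move=> /Pw m1w m1m; have [m10|m1_gt0] := posnP (m1 ord_max).
      have := mpow_no_max m10 (b := m'); rewrite mcoeffB mcoeffX => E.
      have -> : ('X_[m1] \mPo y)@_m' = 0; last by rewrite mulr0.
      have := E; rewrite m1w; have -> : (m1 == m') = false.
        by apply/eqP => e; move: m'w h_gt0; rewrite -e m1w; lia.
      by rewrite subr0; apply; lia.
    have [m2 m1E [m20 m2w]] := max_split m1w m1_gt0.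
    have := mpow_one_max m20 (b := m'); rewrite -m1E mcoeffB mcoeffZ mcoeffX.
    have -> : (m2 == m') = false.
      by apply/eqP => e; move: m1m; rewrite m1E mE e eqxx.
    rewrite mulr0 subr0 => ->; first by rewrite mulr0.
    by rewrite m2w -m'w; lia.
  have Emm : ('X_[m] \mPo y)@_m' = k.
    have := mpow_one_max m'0 (b := m'); rewrite -mE mcoeffB mcoeffZ mcoeffX eqxx mulr1.
    by move=> E; apply/eqP; rewrite -subr_eq0; apply/eqP/E; lia.
  have [mP|mP] := boolP (m \in msupp P).
    rewrite (bigD1_seq m) //= ?msupp_uniq // Emm mulrC big1_seq ?addr0 //.
    by move=> m1 /andP[m1m m1P]; apply: supp1.
  rewrite big_seq big1 => [|m1 m1P].
    by move: mP; rewrite -mcoeff_eq0 => /eqP ->; rewrite mulr0.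
  by apply: supp1 => //; apply: contraNneq mP => <-.
move: coefE; rewrite PyE mcoeffD mcoeffC Gw ?addr0 => [e|]; last by lia.
apply: (mulfI k_neq0); rewrite -e mulrA [k * _]mulrC divfK //; congr (_ * _%:R).
by rewrite mE -[in RHS](addm0 U_(ord_max)%MM) -addmA eqm_add2l add0m.
Qed.

(** Compare coefficients at m, of weight w. A product without y_n contributes only its own monomial.
    Among those with y_n only y_n itself can occur in P, and below weight 2h it is k + X_n, which
    does not involve m. *)
Lemma coef_without_max (m : 'X_{1..n.+1}) : wdeg d m = w -> m ord_max = 0%N -> P@_m = G@_m.
Proof.
move=> mw m0; have m_neq0 : (m == 0%MM) = false.
  by apply/eqP => e; move: w_gt0; rewrite -mw e wdeg0.
have supp1 m1 : m1 \in msupp P -> m1 != m ->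
    P@_m1 * ('X_[m1] \mPo y)@_m = 0.
  move=> m1P m1m; have m1w := Pw m1P; have [m10|m1_gt0] := posnP (m1 ord_max).
    have := mpow_no_max m10 (b := m); rewrite mcoeffB mcoeffX (negbTE m1m).
    rewrite subr0 => ->; first by rewrite mulr0.
    by rewrite m1w mw; have := d_gt0 ord_max; rewrite -/h; lia.
  rewrite (coef_with_max m1w m1_gt0); have [e|_] := eqVneq m1 U_(ord_max)%MM.
    have -> : ('X_[m1] \mPo y)@_m = 0; last by rewrite mulr0.
    rewrite e comp_mpoly_tnth; have := fun j => @yE j m; rewrite -/h mw.
    move=> /(_ ord_max w_lt); rewrite !mcoeffB mcoeffC m_neq0 mulr0 subr0.
    rewrite mcoeffX; move/eqP; rewrite subr_eq0 => /eqP ->.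
    by rewrite -e (negbTE m1m).
  by rewrite mulr0 mul0r.
have Emm : ('X_[m] \mPo y)@_m = 1.
  have := mpow_no_max m0 (b := m); rewrite mcoeffB mcoeffX eqxx.
  move=> E; apply/eqP; rewrite -subr_eq0; apply/eqP/E.
  by have := d_gt0 ord_max; rewrite -/h; lia.
have <- : (P \mPo y)@_m = P@_m; last first.
  by rewrite PyE mcoeffD mcoeffC m_neq0 mulr0 add0r.
rewrite coef_comp; have [mP|mP] := boolP (m \in msupp P).
  rewrite (bigD1_seq m) //= ?msupp_uniq // Emm mulr1 big1_seq ?addr0 //.
  by move=> m1 /andP[m1m m1P]; apply: supp1.
rewrite big_seq big1 => [|m1 m1P].
  by move: mP; rewrite -mcoeff_eq0 => /eqP ->.
by apply: supp1 => //; apply: contraNneq mP => <-.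
Qed.

Lemma leading_terms_determine bound : (w < bound)%N ->
  P = (delta / k) *: 'X_ord_max +
      \sum_(m : 'X_{1..n.+1 < bound} | (m ord_max == 0%N) && (wdeg d m == w))
         G@_m *: 'X_[m].
Proof.
move=> wb; apply/mpolyP => m; rewrite mcoeffD mcoeffZ mcoeffX raddf_sum /=.
under eq_bigr => m1 _ do rewrite mcoeffZ mcoeffX.
have [/andP[/eqP m0 /eqP mw]|mno] := boolP ((m ord_max == 0%N) && (wdeg d m == w)).
  have mb : (mdeg m < bound)%N.
    by apply: leq_ltn_trans (mdeg_le_wdeg m d_gt0) _; rewrite mw.
  rewrite (bigD1 (BMultinom mb)) /= ?m0 ?mw ?eqxx //= mulr1 big1 ?addr0.
    have -> : (U_(ord_max)%MM == m) = false.
      by apply/eqP => e; move: m0; rewrite -e mnm1E eqxx.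
    by rewrite mulr0 add0r coef_without_max.
  move=> m1 /andP[_ m1m]; case: eqP => [e|_]; last by rewrite mulr0.
  by case/eqP: m1m; apply: val_inj.
rewrite big1 ?addr0; last first.
  move=> m1 m1P; case: eqP => [e|_]; last by rewrite mulr0.
  by move: m1P; rewrite e (negbTE mno).
have [mw|mw] := eqVneq (wdeg d m) w.
  rewrite coef_with_max 1?eq_sym // lt0n.
  by apply: contraNN mno => ->; rewrite mw eqxx.
have -> : P@_m = 0.
  by apply/eqP; rewrite mcoeff_eq0; apply: contraNN mw => /Pw ->.
have [e|_] := eqVneq U_(ord_max)%MM m; last by rewrite mulr0.
(* A nonzero [delta] forces w = h, the weight of X_n, so X_n cannot be a monomial of wrong
   weight. *)
have [->|/delta_w wh] := eqVneq delta 0; first by rewrite !mul0r.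
by move: mw; rewrite -e wdegU wh eqxx.
Qed.

End Comparison.

(** * Homogeneous polynomials under scaling and weighted substitution *)

Section Homogeneity.
Variables (K : fieldType) (n k : nat).
Implicit Types (F : {mpoly K[n]}) (t : n.-tuple {mpoly K[k]}).

Lemma dhomog_mderiv e j F : F \is e.-homog -> F^`M(j) \is (e.-1).-homog.
Proof.
move=> homF; apply/dhomogP => m; rewrite mcoeff_msupp mcoeff_mderiv => Fm.
have : (m + U_(j))%MM \in msupp F.
  by rewrite mcoeff_msupp; apply: contraNneq Fm => ->; rewrite mul0rn.
by move=> /(dhomog_mf homF) /=; rewrite mdegD mdeg1 => <-; rewrite addn1.
Qed.

Lemma comp_homog_scale e c F t : F \is e.-homog ->
  F \mPo [tuple c *: tnth t i | i < n] = c ^+ e *: (F \mPo t).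
Proof.
move=> homF; rewrite !comp_mpolyE scaler_sumr; apply: eq_big_seq => m mF.
rewrite [RHS]scalerA [c ^+ e * _]mulrC -scalerA.
congr (_ *: _).
under eq_bigr => i _ do rewrite tnth_mktuple exprZn.
rewrite scaler_prod; congr (_ *: _).
by rewrite -(dhomog_mf homF mF) /= mdegE expr_sum.
Qed.

Lemma mcoeff_comp_scale (c : 'I_n -> K) F m :
  (F \mPo [tuple c i *: 'X_i | i < n])@_m = (\prod_i c i ^+ m i) * F@_m.
Proof.
rewrite comp_mpolyEX raddf_sum /= [in RHS](mpolyE F) raddf_sum mulr_sumr /=.
apply: eq_bigr => m1 _.
have -> : 'X_[m1] \mPo [tuple c i *: 'X_i | i < n] =
    (\prod_i c i ^+ m1 i) *: 'X_[m1] :> {mpoly K[n]}.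
  rewrite comp_mpolyX mpolyXE_id -scaler_prod; apply: eq_bigr => i _.
  by rewrite tnth_mktuple exprZn.
rewrite !mcoeffZ mcoeffX.
by case: eqP => [->|_]; rewrite ?mulr1 ?mulr0 // mulrC.
Qed.

Lemma dhomog_mpow (d : 'I_n -> nat) t m :
  (forall i, tnth t i \is (d i).-homog) -> 'X_[m] \mPo t \is (wdeg d m).-homog.
Proof.
move=> homt; rewrite comp_mpolyX /wdeg.
elim/big_ind2: _ => [|F1 e1 F2 e2|i _]; first exact: dhomog1.
  by move=> h1 h2; apply: dhomogM.
exact: dhomogMn.
Qed.

(* Discarding the terms of wrong weight does not change the value. *)
Lemma dhomog_comp_lift (d : 'I_n -> nat) t w (p : {mpoly K[n]}) :
  (forall i, tnth t i \is (d i).-homog) -> p \mPo t \is w.-homog ->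
  exists2 P : {mpoly K[n]},
    p \mPo t = P \mPo t & forall m, m \in msupp P -> wdeg d m = w.
Proof.
move=> homt homp.
pose P : {mpoly K[n]} := \sum_(m <- msupp p | wdeg d m == w) p@_m *: 'X_[m].
exists P => [|m].
  rewrite -(pihomog_dE homp) [in LHS]comp_mpolyEX !raddf_sum /= [RHS]big_mkcond /=.
  apply: eq_bigr => m _; rewrite linearZ /= comp_mpolyZ.
  have := dhomog_mpow m homt; have [->|/eqP mw] := altP (wdeg d m =P w).
    by move=> hom; rewrite pihomog_dE.
  by move=> hom; rewrite (pihomog_ne0 _ hom) ?scaler0 //; apply/eqP.
rewrite mcoeff_msupp raddf_sum /= => Pm; apply/eqP; apply: contraNT Pm => mw.
rewrite big1 // => m1 /eqP m1w; rewrite mcoeffZ mcoeffX.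
case: eqP => [e|_]; last by rewrite mulr0.
by move: mw; rewrite -e m1w eqxx.
Qed.

End Homogeneity.

(** * Invariance and degree of I^*_G(dF, dH) *)

Lemma exchange_big_pairs (V : nmodType) (I J : finType) (f : I -> I -> J -> J -> V) :
  \sum_i \sum_j \sum_a \sum_b f i j a b = \sum_a \sum_b \sum_i \sum_j f i j a b.
Proof.
rewrite pair_big [RHS]pair_big /=.
under eq_bigr => p _ do rewrite pair_big /=.
under [RHS]eq_bigr => p _ do rewrite pair_big /=.
exact: exchange_big.
Qed.

Lemma scale_mulACA (K : comNzRingType) (A : algType K) (c a b : K) (u v : A) :
  c *: ((a *: u) * (b *: v)) = (c * a * b) *: (u * v).
Proof. by rewrite -scalerAl scalerA -scalerAr scalerA. Qed.

Section InvariantForm.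
Variables (R : realType) (gT : finGroupType) (G : {group gT}) (n : nat).
Local Notation C := R[i].
Variable rG : mx_representation C G n.
Implicit Types (F H : {mpoly C[n]}) (z : n.-tuple {mpoly C[n]}) (I : 'M[C]_n).

Lemma bformD I u1 u2 v : bform I (u1 + u2) v = bform I u1 v + bform I u2 v.
Proof. by rewrite /bform !mulmxDl mxE. Qed.

Lemma bformDr I u v1 v2 : bform I u (v1 + v2) = bform I u v1 + bform I u v2.
Proof. by rewrite /bform raddfD mulmxDr mxE. Qed.

Lemma bformZ I c u v : bform I (c *: u) v = c * bform I u v.
Proof. by rewrite /bform -!scalemxAl mxE. Qed.

Lemma bformZr I c u v : bform I u (c *: v) = c * bform I u v.
Proof. by rewrite /bform linearZ /= -scalemxAr mxE. Qed.

Lemma bform_delta I i j : bform I (delta_mx 0 i) (delta_mx 0 j) = I i j.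
Proof. by rewrite /bform -rowE trmx_delta -colE !mxE. Qed.

(** Every vector is u + i w with u, w in [VR], so invariance extends from [VR] to V by bilinearity;
    the standard basis then gives the matrix identity. *)
Lemma invariant_gram VR I h :
  stable_real_form rG VR -> extends_invariant_inner_product rG VR I ->
  h \in G -> rG h *m I *m (rG h)^T = I.
Proof.
move=> [_ _ _ dec] [_ _ _ inv] hG.
have invV u v : bform I (u *m rG h) (v *m rG h) = bform I u v.
  have [[u1 u2] [[/= u1R u2R ->] _]] := dec u.
  have [[v1 v2] [[/= v1R v2R ->] _]] := dec v.
  rewrite !mulmxDl -!scalemxAl !(bformD, bformDr, bformZ, bformZr).
  by rewrite !inv.
apply/matrixP => i j; rewrite -(bform_delta I i j) -invV -bform_delta.
by rewrite /bform trmx_mul !mulmxA.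
Qed.

(** The hypothesis makes I^-1 A I a left inverse of A^T, hence also a right inverse. *)
Lemma invariant_gram_inv (I A : 'M[C]_n) : I \in unitmx ->
  A *m I *m A^T = I -> A^T *m invmx I *m A = invmx I.
Proof.
move=> Iu AI; have : invmx I *m A *m I *m A^T = 1%:M.
  by rewrite -(mulmxA _ A I) -(mulmxA _ (A *m I)) AI mulVmx.
move/mulmx1C; rewrite !mulmxA => e.
by rewrite -[LHS](mulmxK Iu) e mul1mx.
Qed.

Lemma dual_bformE z I a b :
  dual_bform I (tnth z a) (tnth z b) = (coord_mx z *m invmx I *m (coord_mx z)^T) a b.
Proof.
rewrite /dual_bform !mxE exchange_big; apply: eq_bigr => k _ /=.
rewrite !mxE mulr_suml; apply: eq_bigr => j _.
by rewrite !mxE mulrAC.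
Qed.

(** Independence of the basis z: in the standard coordinates the group acts through the matrices of
    [rG]. *)
Lemma IG_diffE z I F H : C_basis (@is_linear_form R n) z ->
  IG_diff I z F H = \sum_j \sum_k invmx I j k *: (F^`M(j) * H^`M(k)).
Proof.
move=> zb; have E j k : invmx I j k *: (F^`M(j) * H^`M(k)) =
    \sum_a \sum_b (coord_mx z a j * coord_mx z b k * invmx I j k) *:
      (pderiv z U_(a) F * pderiv z U_(b) H).
  rewrite (mderiv_pderivU zb j F) (mderiv_pderivU zb k H) mulr_suml scaler_sumr.
  apply: eq_bigr => a _; rewrite mulr_sumr scaler_sumr; apply: eq_bigr => b _.
  rewrite scale_mulACA; congr (_ *: _).
  by rewrite [RHS]mulrC mulrA.
transitivity (\sum_a \sum_b \sum_j \sum_k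
    (coord_mx z a j * coord_mx z b k * invmx I j k) *:
      (pderiv z U_(a) F * pderiv z U_(b) H)); last first.
  rewrite -exchange_big_pairs; apply: eq_bigr => j _; apply: eq_bigr => k _.
  by rewrite E.
apply: eq_bigr => a _; apply: eq_bigr => b _; rewrite /dual_bform scaler_suml.
apply: eq_bigr => j _; rewrite scaler_suml; apply: eq_bigr => k _.
by rewrite !mxE.
Qed.

Lemma mcoeff_poly_act_linear h F k : is_linear_form F ->
  (poly_act rG h F)@_U_(k) = \sum_j rG (h^-1)%g k j * F@_U_(j).
Proof.
move=> /linear_formE FE; have -> : poly_act rG h F =
    \sum_j F@_U_(j) *: (\sum_k rG (h^-1)%g k j *: 'X_k).
  rewrite /poly_act {1}FE raddf_sum /=; apply: eq_bigr => j _.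
  by rewrite comp_mpolyZ comp_mpoly_tnth tnth_mktuple.
rewrite raddf_sum /=; apply: eq_bigr => j _; rewrite mcoeffZ mulrC.
rewrite raddf_sum (bigD1 k) //= big1 => [|l lk].
  by rewrite mcoeffZ mcoeffX eqxx mulr1 addr0.
rewrite mcoeffZ mcoeffX; case: eqP => [/mnmP/(_ k)|_]; last by rewrite mulr0.
by rewrite !mnm1E eqxx (negbTE lk).
Qed.

Lemma mderiv_poly_act h F i :
  (poly_act rG h F)^`M(i) = \sum_j rG (h^-1)%g i j *: poly_act rG h F^`M(j).
Proof.
rewrite /poly_act mderiv_comp; apply: eq_bigr => j _.
rewrite tnth_mktuple -mul_mpolyC mulrC; congr (_ * _).
rewrite (raddf_sum (mderiv i)) (bigD1 i) //= big1 => [|l li].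
  by rewrite mderivZ mderivXU eqxx addr0 -mul_mpolyC mulr1.
by rewrite mderivZ mderivXU eq_sym (negbTE li) scaler0.
Qed.

Lemma mderiv_invariant h F i : poly_act rG h F = F ->
  F^`M(i) = \sum_j rG (h^-1)%g i j *: poly_act rG h F^`M(j).
Proof. by move=> inv; rewrite -{1}inv mderiv_poly_act. Qed.

(** The chain rule produces two factors [rG (h^-1)], which the invariance of I^-1 absorbs. *)
Lemma IG_diff_invariant z I F H : C_basis (@is_linear_form R n) z ->
  I \in unitmx -> (forall h, h \in G -> rG h *m I *m (rG h)^T = I) ->
  poly_invariant rG F -> poly_invariant rG H ->
  poly_invariant rG (IG_diff I z F H).
Proof.
move=> zb Iu Iinv Finv Hinv h hG.
have /matrixP Jinv := invariant_gram_inv Iu (Iinv _ (groupVr hG)).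
rewrite IG_diffE //; transitivity (\sum_j \sum_k \sum_l \sum_m
    (invmx I j k * rG (h^-1)%g j l * rG (h^-1)%g k m) *:
      (poly_act rG h F^`M(l) * poly_act rG h H^`M(m))); last first.
  apply: eq_bigr => j _; apply: eq_bigr => k _.
  rewrite (mderiv_invariant j (Finv h hG)) (mderiv_invariant k (Hinv h hG)).
  rewrite mulr_suml scaler_sumr; apply: eq_bigr => l _.
  rewrite mulr_sumr scaler_sumr; apply: eq_bigr => m _.
  exact/esym/scale_mulACA.
rewrite exchange_big_pairs /poly_act raddf_sum /=; apply: eq_bigr => l _.
rewrite raddf_sum /=; apply: eq_bigr => m _.
rewrite comp_mpolyZ rmorphM /= -Jinv !mxE scaler_suml exchange_big /=.
apply: eq_bigr => k _; rewrite mxE mulr_suml scaler_suml; apply: eq_bigr => j _.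
rewrite !mxE; congr (_ *: _); ring.
Qed.

Lemma dhomog_IG_diff z I F H e1 e2 : C_basis (@is_linear_form R n) z ->
  F \is e1.-homog -> H \is e2.-homog ->
  IG_diff I z F H \is (e1.-1 + e2.-1).-homog.
Proof.
move=> zb homF homH; rewrite IG_diffE //.
apply: rpred_sum => j _; apply: rpred_sum => k _.
by apply/rpredZ/dhomogM; apply: dhomog_mderiv.
Qed.

End InvariantForm.

(** * Invariant quadratic forms and Schur's argument *)

Section Hessian.
Variables (R : realType) (n : nat).
Local Notation C := R[i].
Implicit Types (F H : {mpoly C[n]}).

(** Twice the Gram matrix of the quadratic part of F. *)
Definition hessian0 F : 'M[C]_n := \matrix_(i, j) (F^`M(i)^`M(j))@_0%MM.

Lemma hessian0B F H c : hessian0 (F - c *: H) = hessian0 F - c *: hessian0 H.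
Proof.
apply/matrixP => i j.
by rewrite !mxE !(mderivB, mderivZ) mcoeffB mcoeffZ.
Qed.

Lemma hessian0_eq0 F : F \is 2.-homog -> hessian0 F = 0 -> F = 0.
Proof.
move=> homF /matrixP S0; apply/mpolyP => m; rewrite mcoeff0.
have [m2|m2] := eqVneq (mdeg m) 2; last by rewrite (dhomog_nemf_coeff homF m2).
have [i mi] : exists i, (0 < m i)%N.
  apply/existsP; apply: contraT => /existsPn m0; move: m2; rewrite mdegE big1 // => i _.
  by apply/eqP; rewrite -leqn0 leqNgt m0.
have mE : m = ((m - U_(i)) + U_(i))%MM.
  by apply/mnmP => j; rewrite mnmDE mnmBE mnm1E; case: eqP => [<-|//]; lia.
have : mdeg (m - U_(i))%MM == 1%N.
  by move: m2; rewrite {1}mE mdegD mdeg1 => /eqP; rewrite addn1 eqSS.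
move=> /mdeg1P[j /eqP mj]; have := S0 i j; rewrite !mxE !mcoeff_mderiv add0m.
rewrite -mj -mE => /eqP; rewrite mnm0E mulr1n -mulr_natr mulf_eq0 pnatr_eq0.
by rewrite orbF => /eqP.
Qed.

Variables (gT : finGroupType) (G : {group gT}) (rG : mx_representation C G n).

Lemma poly_act_mcoeff0 h F : (poly_act rG h F)@_0%MM = F@_0%MM.
Proof.
rewrite -!(@mcoeff0_meval _ _ _ (fun=> 0)) // comp_mpoly_meval.
apply: meval_eq => i; rewrite tnth_mktuple meval_sum big1 // => k _.
by rewrite mevalZ mevalXU mulr0.
Qed.

(** Differentiate the invariance under h^-1 twice: each derivative brings out a factor [rG h], and a
    linear substitution keeps the value at 0. *)
Lemma hessian0_invariant h F : poly_invariant rG F -> h \in G ->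
  rG h *m hessian0 F *m (rG h)^T = hessian0 F.
Proof.
move=> inv hG; apply/matrixP => i k.
have derivF j : F^`M(j) = \sum_l rG h j l *: poly_act rG h^-1%g F^`M(l).
  by rewrite (mderiv_invariant _ (inv _ (groupVr hG))) invgK.
have derivFF : F^`M(i)^`M(k) =
    \sum_j \sum_l (rG h i j * rG h k l) *: poly_act rG h^-1%g F^`M(j)^`M(l).
  rewrite derivF (raddf_sum (mderiv k)) /=; apply: eq_bigr => j _.
  rewrite mderivZ mderiv_poly_act invgK scaler_sumr.
  by apply: eq_bigr => l _; rewrite scalerA.
rewrite [in RHS]mxE derivFF raddf_sum /= [LHS]mxE.
under [RHS]eq_bigr => j _ do rewrite raddf_sum /=.
rewrite exchange_big /=; apply: eq_bigr => l _; rewrite [(_ *m _) _ _]mxE.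
rewrite mulr_suml; apply: eq_bigr => j _.
by rewrite mcoeffZ poly_act_mcoeff0 !mxE mulrAC.
Qed.

Hypothesis irr : mx_irreducible rG.

(** The kernel of B is a submodule, hence zero or everything. *)
Lemma invariant_form_unit (B : 'M[C]_n) :
  (forall h, h \in G -> rG h *m B *m (rG h)^T = B) -> B = 0 \/ B \in unitmx.
Proof.
move=> Binv; have [_ _ min] := irr.
have stab : mxmodule rG (kermx B).
  apply/mxmoduleP => h hG; apply/sub_kermxP.
  have hu : (rG h)^T \in unitmx by rewrite unitmx_tr repr_mx_unit.
  apply: (can_inj (mulmxK hu)); rewrite mul0mx.
  have := congr1 (mulmx (kermx B)) (Binv h hG).
  by rewrite mulmx_ker !mulmxA.
have [k0|kn0] := eqVneq (kermx B) 0.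
  by right; rewrite -row_free_unit -kermx_eq0 k0.
have /sub_kermxP := min _ stab (submx1 _) kn0.
by rewrite mul1mx; left.
Qed.

End Hessian.

(** * Degrees of basic invariants: at least 2, and 2 only once *)

Section Degrees.
Variables (R : realType) (gT : finGroupType) (G : {group gT}) (n : nat).
Local Notation C := R[i].
Variables (rG : mx_representation C G n.+1) (d : 'I_n.+1 -> nat).
Variable x : n.+1.-tuple {mpoly C[n.+1]}.
Hypothesis irr : mx_irreducible rG.
Hypothesis hx : basic_invariants rG d x.

Lemma basic_invariants_free (p : {mpoly C[n.+1]}) m : p \mPo x = 0 -> p@_m = 0.
Proof. by have [_ free _ _] := hx => /free ->; rewrite mcoeff0. Qed.

Lemma basic_invariant_neq0 a : tnth x a != 0.
Proof.
apply/eqP => xa; have := @basic_invariants_free 'X_a U_(a)%MM.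
by rewrite comp_mpoly_tnth => /(_ xa)/eqP; rewrite mcoeffX eqxx oner_eq0.
Qed.

(** A constant c among the generators would satisfy the relation X_a - c = 0. *)
Lemma degree_neq0 a : d a != 0%N.
Proof.
apply/eqP => da0; have [/(_ a)[_ homx] _ _ _] := hx.
have xaE : tnth x a = ((tnth x a)@_0%MM)%:MP.
  apply/mpolyP => m; rewrite mcoeffC; case: eqP => [->|m0]; first by rewrite mulr1.
  rewrite mulr0 (dhomog_nemf_coeff homx) // da0 /= mdeg_eq0; exact/eqP.
have := @basic_invariants_free ('X_a - ((tnth x a)@_0%MM)%:MP) U_(a)%MM.
rewrite comp_mpolyB comp_mpoly_tnth comp_mpolyC {1}xaE subrr => /(_ erefl).
rewrite mcoeffB mcoeffX mcoeffC eqxx mnm1_eq0 mulr0 subr0 => /eqP.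
by rewrite oner_eq0.
Qed.

(** The kernel of a nonzero invariant linear form is a proper submodule, hence 0. Then the dimension
    is 1 and G acts trivially, against faithfulness. *)
Lemma degree_neq1 a : mx_faithful rG -> G :!=: 1%g -> d a != 1%N.
Proof.
move=> faith G1; apply/eqP => da1; have [/(_ a)[inv homx] _ _ _] := hx.
rewrite da1 in homx; have xaE := linear_formE homx.
pose c : 'cV[C]_n.+1 := \col_j (tnth x a)@_U_(j).
have c_neq0 : c != 0.
  apply: contraNneq (basic_invariant_neq0 a) => c0; rewrite xaE big1 // => j _.
  by have /matrixP/(_ j 0) := c0; rewrite !mxE => ->; rewrite scale0r.
have cinv h : h \in G -> rG h *m c = c.
  move=> hG; apply/colP => k; have := congr1 (mcoeff U_(k)%MM) (inv _ (groupVr hG)).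
  rewrite mcoeff_poly_act_linear // invgK !mxE => <-.
  by apply: eq_bigr => j _; rewrite mxE.
have stab : mxmodule rG (kermx c).
  apply/mxmoduleP => h hG; apply/sub_kermxP.
  by rewrite -mulmxA cinv // mulmx_ker.
have [_ _ min] := irr; have [k0|kn0] := eqVneq (kermx c) 0; last first.
  have /sub_kermxP := min _ stab (submx1 _) kn0.
  by rewrite mul1mx => c0; rewrite c0 eqxx in c_neq0.
have := mxrank_ker c; rewrite k0 mxrank0 => /esym/eqP.
rewrite subn_eq0 => /leq_trans/(_ (rank_leq_col c)); rewrite ltnS leqn0 => /eqP n0.
case/negP: G1; rewrite eqEsubset sub1G andbT; apply/subsetP => h hG.
rewrite inE; apply/eqP/(mx_faithful_inj faith) => //.
have ord1 (i : 'I_n.+1) : i = 0.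
  by apply/val_inj/eqP; rewrite /= -leqn0 -n0 -ltnS.
rewrite repr_mx1; apply/matrixP => i j; rewrite (ord1 i) (ord1 j) mxE eqxx.
have c00 : c 0 0 != 0.
  apply: contraNneq c_neq0 => c0; apply/eqP/colP => k.
  by rewrite (ord1 k) c0 mxE.
apply: (mulIf c00); rewrite mul1r; have /matrixP/(_ 0 0) := cinv h hG.
rewrite mxE (bigD1 0) //= big1 ?addr0 // => k.
by rewrite (ord1 k) eqxx.
Qed.

(* By Schur's lemma the invariant bilinear forms are proportional. *)
Lemma quadratic_invariant_unique a b : d a = 2%N -> d b = 2%N -> a = b.
Proof.
move=> da db; have [/(_ a)[inva homa] _ _ _] := hx.
have [/(_ b)[invb homb] _ _ _] := hx; rewrite da in homa; rewrite db in homb.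
pose S1 := hessian0 (tnth x a); pose S2 := hessian0 (tnth x b).
have S1u : S1 \in unitmx.
  have [|//] := invariant_form_unit irr (fun h => @hessian0_invariant _ _ _ _ rG h _ inva).
  by move/(hessian0_eq0 homa) => x0; case/eqP: (basic_invariant_neq0 a).
have [|l] := closed_rootP (char_poly (S2 *m invmx S1)) _.
  by rewrite size_char_poly.
rewrite -eigenvalue_root_char => /eigenvalueP[v vE v0].
(* The eigenvalue l of S2 S1^-1 makes the Hessian of F singular, so F = 0 by Schur; for a != b this
   is an algebraic relation. *)
pose F := tnth x b - l *: tnth x a.
have vS : v *m hessian0 F = 0.
  rewrite hessian0B mulmxBr -scalemxAr -/S1 -/S2 scalemxAl -vE.
  by rewrite mulmxA mulmxKV // subrr.
have invF : poly_invariant rG F.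
  move=> h hG; transitivity (poly_act rG h (tnth x b) - l *: poly_act rG h (tnth x a)).
    by rewrite /poly_act comp_mpolyB comp_mpolyZ.
  by rewrite (invb h hG) (inva h hG).
have F0 : F = 0.
  have homF : F \is 2.-homog by rewrite rpredB // rpredZ.
  have [S0|Su] := invariant_form_unit irr (fun h => @hessian0_invariant _ _ _ _ rG h _ invF).
    exact: hessian0_eq0.
  by case/eqP: v0; rewrite -(mulmxK Su v) vS mul0mx.
apply/eqP; apply: contraT => ab.
have := @basic_invariants_free ('X_b - l *: 'X_a) U_(b)%MM.
rewrite comp_mpolyB comp_mpolyZ !comp_mpoly_tnth => /(_ F0) /eqP.
rewrite mcoeffB mcoeffZ !mcoeffX eqxx.
have -> : (U_(a)%MM == U_(b)%MM :> 'X_{1..n.+1}) = false.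
  by apply/eqP => /mnmP/(_ b); rewrite !mnm1E eqxx (negbTE ab).
by rewrite mulr0 subr0 oner_eq0.
Qed.

End Degrees.

(** * Congruences modulo d_n forced by g q = zeta q *)

Section Eigenvector.
Variables (R : realType) (gT : finGroupType) (G : {group gT}) (n : nat).
Local Notation C := R[i].
Variables (rG : mx_representation C G n) (d : 'I_n -> nat).
Variables (g : gT) (zeta : C) (q : 'rV[C]_n) (z : n.-tuple {mpoly C[n]}).
Hypothesis gG : g \in G.
Hypothesis zeta_neq0 : zeta != 0.
Hypothesis d_gt0 : forall j, (0 < d j)%N.
Hypothesis qg : q *m rG g = zeta *: q.
Hypothesis hz : homogeneous_basis rG d g zeta z.

Let A := rG (g^-1)%g.
Let D : 'M[C]_n := diag_mx (\row_a zeta ^+ (d a - 1)).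

Lemma coord_mx_eigen : coord_mx z *m A^T = D *m coord_mx z.
Proof.
have [zb eig] := hz; have [lin _ _] := zb; apply/matrixP => a k.
rewrite mul_diag_mx !mxE.
have := congr1 (mcoeff U_(k)%MM) (eig a).
rewrite (mcoeff_poly_act_linear _ _ _ (lin a)) mcoeffZ => <-.
by apply: eq_bigr => j _; rewrite !mxE mulrC.
Qed.

Lemma eigenvector_inv : q *m A = zeta^-1 *: q.
Proof.
apply: (scalerI zeta_neq0); rewrite scalerA divff // scale1r scalemxAl -qg.
by rewrite -mulmxA -repr_mxM ?groupV // mulgV repr_mx1 mulmx1.
Qed.

(** The value z^a(g^-1 q) is zeta^(d_a - 1) z^a(q) by the choice of z, and zeta^-1 z^a(q) because q
    is an eigenvector. *)
Lemma meval_coord_eigen a : (tnth z a).@[q 0] != 0 -> zeta ^+ d a = 1.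
Proof.
move=> za; have [zb _] := hz.
have zaE (v : 'rV[C]_n) : (tnth z a).@[v 0] = (coord_mx z *m v^T) a 0.
  rewrite coord_mxE // meval_sum !mxE; apply: eq_bigr => j _.
  by rewrite mevalZ mevalXU; congr (_ * _); rewrite mxE.
have : (coord_mx z *m (q *m A)^T) a 0 = zeta ^+ (d a - 1) * (tnth z a).@[q 0].
  by rewrite trmx_mul mulmxA coord_mx_eigen -mulmxA mul_diag_mx mxE mxE zaE.
rewrite eigenvector_inv linearZ /= -scalemxAr mxE -zaE => /(mulIf za) e.
by rewrite -(subnK (d_gt0 a)) addn1 exprS -e divff.
Qed.

(** One has g^-1 (q + u) = zeta^-1 (q + S u), where S multiplies u_a by zeta^(d_a). Invariance gives
    F(q + u) = F(g^-1 (q + u)), and homogeneity takes out zeta^-e. *)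
Lemma recenter_eigen F e : poly_invariant rG F -> F \is e.-homog ->
  recenter z q F =
    zeta^-1 ^+ e *: (recenter z q F \mPo [tuple zeta ^+ d a *: 'X_a | a < n]).
Proof.
move=> inv homF; have [zb _] := hz; set S := [tuple zeta ^+ _ *: _ | _ < _].
have SE a : tnth S a = zeta ^+ d a *: 'X_a by rewrite tnth_mktuple.
move: S SE => S SE.
have AW : A^T *m invmx (coord_mx z) = invmx (coord_mx z) *m D.
  have Zu := coord_mx_unit zb.
  by rewrite -[LHS]mul1mx -(mulVmx Zu) -!mulmxA (mulmxA _ A^T) coord_mx_eigen -mulmxA mulmxV // mulmx1.
pose r j : {mpoly C[n]} := \sum_(a < n) invmx (coord_mx z) j a *: 'X_a + (q 0 j)%:MP.
(* The j-th coordinate of g^-1 (q + u) = zeta^-1 (q + S u). *)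
have rS j : \sum_k A k j *: r k = zeta^-1 *: (r j \mPo S).
  under eq_bigr => k _ do rewrite scalerDr scaler_sumr.
  rewrite big_split /= exchange_big /= /r comp_mpolyD comp_mpolyC scalerDr.
  congr (_ + _).
    rewrite [X in _ = _ *: X]raddf_sum scaler_sumr /=; apply: eq_bigr => a _.
    under eq_bigr => k _ do rewrite scalerA.
    rewrite comp_mpolyZ comp_mpoly_tnth SE !scalerA -scaler_suml.
    congr (_ *: _); transitivity ((A^T *m invmx (coord_mx z)) j a).
      by rewrite mxE; apply: eq_bigr => k _; rewrite mxE.
    rewrite AW mul_mx_diag !mxE mulrAC [RHS]mulrC.
    by congr (_ * _); rewrite -{2}(subnK (d_gt0 a)) addn1 exprS mulrA mulVf ?mul1r.
  have /rowP/(_ j) := eigenvector_inv; rewrite !mxE => e1.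
  under eq_bigr => k _ do rewrite -mul_mpolyC -mpolyCM.
  rewrite -mul_mpolyC -mpolyCM -e1 (raddf_sum (mpolyC n (R := C))) /=.
  by apply: eq_bigr => k _; rewrite mulrC.
have actE : recenter z q (poly_act rG g F) =
    F \mPo [tuple \sum_k A k j *: r k | j < n].
  rewrite /recenter /poly_act comp_mpolyA; apply: eq_comp_mpoly => j.
  rewrite [LHS]tnth_mktuple [RHS]tnth_mktuple tnth_mktuple raddf_sum /=.
  by apply: eq_bigr => k _; rewrite comp_mpolyZ comp_mpoly_tnth tnth_mktuple.
rewrite -{1}(inv g gG) actE.
have -> : recenter z q F \mPo S = F \mPo [tuple r j \mPo S | j < n].
  rewrite /recenter comp_mpolyA; apply: eq_comp_mpoly => j.
  by rewrite [RHS]tnth_mktuple [LHS]tnth_mktuple; congr (_ \mPo _); rewrite tnth_mktuple.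
rewrite -(comp_homog_scale _ _ homF); apply: eq_comp_mpoly => j.
by rewrite [LHS]tnth_mktuple [RHS]tnth_mktuple tnth_mktuple rS.
Qed.

Lemma recenter_coef_eigen F e m : poly_invariant rG F -> F \is e.-homog ->
  (recenter z q F)@_m != 0 -> zeta ^+ wdeg d m = zeta ^+ e.
Proof.
move=> inv homF Fm; have := recenter_eigen inv homF.
move: (recenter z q F) Fm => T Tm /(congr1 (mcoeff m)).
rewrite mcoeffZ mcoeff_comp_scale mulrA => /esym/eqP.
rewrite -subr_eq0 -[X in _ - X]mul1r -mulrBl mulf_eq0 (negbTE Tm) orbF subr_eq0.
have -> : \prod_i (zeta ^+ d i) ^+ m i = zeta ^+ wdeg d m.
  by rewrite /wdeg expr_sum; apply: eq_bigr => i _; rewrite exprM.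
move=> /eqP e1; have ze : zeta ^+ e != 0 by rewrite expf_neq0.
by rewrite -[LHS]mul1r -(divff ze) -mulrA -exprVn e1 mulr1.
Qed.

(** By g-invariance the Gram matrix Q of I^* in the basis z satisfies Q = D Q D, so the eigenvalues
    at a nonzero entry multiply to 1. *)
Lemma dual_form_eigen I a b : I \in unitmx ->
  (forall h, h \in G -> rG h *m I *m (rG h)^T = I) ->
  dual_bform I (tnth z a) (tnth z b) != 0 ->
  zeta ^+ (d a - 1 + (d b - 1)) = 1.
Proof.
move=> Iu Iinv; rewrite dual_bformE; set Q := _ *m _ *m _ => Qab.
have QE : Q = D *m Q *m D.
  rewrite /Q !mulmxA -coord_mx_eigen -[in LHS](invariant_gram_inv Iu (Iinv _ (groupVr gG))).
  have -> : coord_mx z *m A^T *m invmx I *m (coord_mx z)^T *m D =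
      coord_mx z *m A^T *m invmx I *m (D *m coord_mx z)^T.
    by rewrite trmx_mul tr_diag_mx mulmxA.
  by rewrite -coord_mx_eigen trmx_mul trmxK !mulmxA.
move: (Q) Qab QE => Q0 Qab /(congr1 (fun M : 'M_n => M a b)).
rewrite /= mul_mx_diag mxE mul_diag_mx !mxE mulrAC -{1}[Q0 a b]mul1r.
by move=> /(mulIf Qab) e; rewrite exprD -e.
Qed.

End Eigenvector.

(** * Goodness in terms of Taylor coefficients *)

Section GoodInvariants.
Variables (R : realType) (n : nat).
Local Notation C := R[i].
Variables (d : 'I_n -> nat) (z x : n.-tuple {mpoly C[n]}) (q : 'rV[C]_n).
Hypothesis zb : C_basis (@is_linear_form R n) z.
Hypothesis d_gt0 : forall j, (0 < d j)%N.

Lemma mfact_neq0 (m : 'X_{1..n}) : (mfact m)%:R != 0 :> C.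
Proof.
rewrite pnatr_eq0 -lt0n /mfact; apply: prodn_gt0 => j; exact: fact_gt0.
Qed.

Lemma taylor_coef m F :
  (mfact m)%:R^-1 * (pderiv z m F).@[q 0] = (recenter z q F)@_m.
Proof.
by rewrite meval_pderiv // -[X in _ * X]mulr_natl mulKf // mfact_neq0.
Qed.

Lemma shifted_mpowU a :
  shifted_mpow x q U_(a) = tnth x a - ((tnth x a).@[q 0])%:MP.
Proof.
rewrite /shifted_mpow (bigD1 a) //= mnm1E eqxx expr1 big1 ?mulr1 // => j ja.
by rewrite mnm1E eq_sym (negbTE ja) expr0.
Qed.

Lemma psiX a : psi d z x q 'X_a = psi_mpow d z x q U_(a).
Proof. by rewrite /psi msuppX big_seq1 mcoeffX eqxx scale1r. Qed.

Lemma mpow_comp_inv m : mpow z m \mPo coord_inv z = 'X_[m].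
Proof.
rewrite /mpow rmorph_prod mpolyXE_id; apply: eq_bigr => j _ /=.
by rewrite rmorphXn /= coord_comp_inv.
Qed.

Lemma linear_comp_inv F : is_linear_form F -> is_linear_form (F \mPo coord_inv z).
Proof.
move=> /linear_formE ->; rewrite raddf_sum; apply: rpred_sum => j _ /=.
rewrite comp_mpolyZ comp_mpoly_tnth tnth_mktuple; apply/rpredZ/rpred_sum => a _.
by apply: rpredZ; rewrite dhomogX /= mdeg1.
Qed.

(** The value of psi at x^a is the part of weight d_a of the Taylor expansion of x^a - x^a(q);
    goodness makes it a linear form. *)
Lemma good_leading_linear a m :
  (forall p : {mpoly C[n]}, p \mPo x = 0 -> p = 0) -> good d z x q ->
  wdeg d m = d a -> mdeg m != 1%N -> (recenter z q (tnth x a))@_m = 0.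
Proof.
move=> free [/(_ a) [p xp lin] _ _] mw m1.
(* Goodness only provides some p with p(x) = x^a; algebraic independence identifies it. *)
have pX : p = 'X_a.
  apply/eqP; rewrite -subr_eq0; apply/eqP/free.
  by rewrite comp_mpolyB comp_mpoly_tnth -xp subrr.
move: lin; rewrite pX psiX => /linear_comp_inv lin.
have := dhomog_nemf_coeff lin m1.
rewrite /psi_mpow (raddf_sum (comp_mpoly (coord_inv z))).
rewrite (raddf_sum (mcoeff m)) wdegU /=.
have mb : (mdeg m < (d a).+1)%N by rewrite ltnS -mw mdeg_le_wdeg.
have coefE (b : 'X_{1..n}) :
    (((mfact b)%:R^-1 * (pderiv z b (shifted_mpow x q U_(a))).@[q 0]) *: mpow z b
      \mPo coord_inv z)@_m =
    (recenter z q (tnth x a - ((tnth x a).@[q 0])%:MP))@_b * (b == m)%:R.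
  by rewrite comp_mpolyZ mcoeffZ mpow_comp_inv mcoeffX taylor_coef shifted_mpowU.
under eq_bigr => b _ do rewrite coefE.
rewrite (bigD1 (BMultinom mb)) /= ?mw // eqxx mulr1 big1 ?addr0 => [|b /andP[_ bm]].
  rewrite /recenter comp_mpolyB mcoeffB comp_mpolyC mcoeffC.
  have -> : (m == 0%MM) = false.
    by apply/eqP => m0; move: (d_gt0 a); rewrite -mw m0 wdeg0.
  by rewrite mulr0 subr0.
case: eqP => [e|_]; last by rewrite mulr0.
by case/eqP: bm; apply: val_inj.
Qed.

End GoodInvariants.

(** * The form I^*_G in a basis with antidiagonal Gram matrix *)

Lemma gram_unit (R : realType) n (I : 'M[R[i]]_n) (z : n.-tuple {mpoly R[i][n]}) :
  (forall a b : 'I_n,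
     dual_bform I (tnth z a) (tnth z b) = (b == rev_ord a)%:R) ->
  I \in unitmx.
Proof.
move=> hIz; set Q := coord_mx z *m invmx I *m (coord_mx z)^T.
have QE a b : Q a b = (b == rev_ord a)%:R by rewrite -dual_bformE hIz.
have QQ : Q *m Q = 1%:M.
  apply/matrixP => a b; rewrite !mxE (bigD1 (rev_ord a)) //= !QE eqxx mul1r.
  rewrite rev_ordK big1 ?addr0; first by rewrite eq_sym.
  by move=> c ca; rewrite QE (negbTE ca) mul0r.
have [Qu _] := mulmx1_unit QQ.
(* By convention a singular matrix is its own [invmx], so invertibility of [invmx I] gives that of
   [I]. *)
by move: Qu; rewrite !unitmx_mul unitmx_inv => /andP[/andP[]].
Qed.

Lemma IG_diff_antidiagonal (R : realType) n (I : 'M[R[i]]_n)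
    (z : n.-tuple {mpoly R[i][n]}) F H :
  (forall a b : 'I_n,
     dual_bform I (tnth z a) (tnth z b) = (b == rev_ord a)%:R) ->
  IG_diff I z F H = \sum_c pderiv z U_(c) F * pderiv z U_(rev_ord c) H.
Proof.
move=> hIz; apply: eq_bigr => c _; rewrite (bigD1 (rev_ord c)) //= hIz eqxx scale1r.
by rewrite big1 ?addr0 // => e ec; rewrite hIz (negbTE ec) scale0r.
Qed.

Section RecenteredForm.
Variables (R : realType) (n : nat) (q : 'rV[R[i]]_n) (z : n.-tuple {mpoly R[i][n]}).

Lemma recenter_comp_eq (x y : n.-tuple {mpoly R[i][n]}) p :
  (forall j, tnth y j = recenter z q (tnth x j)) ->
  recenter z q (p \mPo x) = p \mPo y.
Proof.
move=> yE; rewrite /recenter comp_mpolyA; apply: eq_comp_mpoly => j.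
by rewrite yE [LHS]tnth_mktuple.
Qed.

Lemma recenter_pderivU F c : C_basis (@is_linear_form R n) z ->
  recenter z q (pderiv z U_(c) F) = (recenter z q F)^`M(c).
Proof. by move=> zb; rewrite recenter_pderiv // mderivmU1m. Qed.

Lemma recenter_pderivUD F H a b : C_basis (@is_linear_form R n) z ->
  recenter z q (pderiv z U_(a) F + pderiv z U_(b) H) =
  (recenter z q F)^`M(a) + (recenter z q H)^`M(b).
Proof.
move=> zb; apply: etrans (recenterD _ _ _ _) _.
by congr (_ + _); apply: recenter_pderivU.
Qed.

Lemma recenter_IG_diff (I : 'M[R[i]]_n) F H : C_basis (@is_linear_form R n) z ->
  (forall a b : 'I_n,
     dual_bform I (tnth z a) (tnth z b) = (b == rev_ord a)%:R) ->
  recenter z q (IG_diff I z F H) =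
  \sum_c (recenter z q F)^`M(c) * (recenter z q H)^`M(rev_ord c).
Proof.
move=> zb /IG_diff_antidiagonal ->.
transitivity (\sum_c recenter z q (pderiv z U_(c) F * pderiv z U_(rev_ord c) H)).
  exact: raddf_sum.
apply: eq_bigr => c _.
apply: etrans (recenterM _ _ _ _) _.
by congr (_ * _); apply: recenter_pderivU.
Qed.

End RecenteredForm.

(** * Arithmetic of degrees modulo h *)

Lemma sum_mul_delta (K : nzRingType) (I : finType) (f : I -> K) i :
  \sum_j f j * (i == j)%:R = f i.
Proof.
rewrite (bigD1 i) //= eqxx mulr1 big1 ?addr0 // => j ji.
by rewrite eq_sym (negbTE ji) mulr0.
Qed.

(** The difference w - e is a multiple of h strictly between -h and h. *)
Lemma eqn_mod_window h e w : (0 < w)%N -> (w < e + h)%N -> (e <= h)%N ->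
  w = e %[mod h] -> w = e.
Proof.
move=> w_gt0 w_lt e_le /eqP; have [le|lt] := leqP e w.
  by rewrite eqn_mod_dvd // => /dvdnP[[|c]]; rewrite ?mulSn; lia.
by rewrite eq_sym eqn_mod_dvd 1?ltnW // => /dvdnP[[|c]]; rewrite ?mulSn; lia.
Qed.

(** The sum lies between 2 and 2h - 2, where h is the only multiple of h. *)
Lemma dual_degree h e1 e2 : (1 < e1 <= h)%N -> (1 < e2 <= h)%N ->
  (h %| e1 - 1 + (e2 - 1))%N -> (e1 + e2 = h + 2)%N.
Proof.
move=> /andP[? ?] /andP[? ?] /dvdnP[[|[|c]]]; rewrite ?mulSn; lia.
Qed.

Lemma weight_window h e1 e2 : (1 < e1 <= h)%N -> (1 < e2 <= h)%N ->
  (0 < e1 + e2 - 2 < h + h)%N.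
Proof. lia. Qed.

Lemma predD2 e1 e2 : (0 < e1)%N -> (0 < e2)%N ->
  (e1.-1 + e2.-1 = e1 + e2 - 2)%N.
Proof. lia. Qed.

(** * Lowest weights of the recentred I^*_G(dx^a, dx^b) *)

Section LeadingTerms.
Variables (K : fieldType) (n : nat) (d : 'I_n -> nat) (h : nat).
Hypothesis d_le : forall j, (d j <= h)%N.
Hypothesis d_ge2 : forall j, (1 < d j)%N.
Hypothesis d_dual : forall j, (d j + d (rev_ord j) = h + 2)%N.
Variables (y : 'I_n -> {mpoly K[n]}) (k : 'I_n -> K).
Hypothesis yE : forall j, weight_ge d (d j + h) (y j - (k j)%:MP - 'X_j).

(* By duality of the degrees, products of two derivatives of the remainders
   have weight at least [d a + d b - 2 + h], so they do not contribute. *)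
Lemma derivative_pairing a b : exists2 E : {mpoly K[n]},
  \sum_c (y a)^`M(c) * (y b)^`M(rev_ord c) = ((b == rev_ord a)%:R)%:MP + E &
  weight_ge d (d a + d b - 2) E /\
  forall m, wdeg d m = (d a + d b - 2)%N ->
    E@_m = ((y a)^`M(rev_ord b) + (y b)^`M(rev_ord a))@_m.
Proof.
pose r j := y j - (k j)%:MP - 'X_j.
have rE j : y j = (k j)%:MP + 'X_j + r j by rewrite /r; ring.
have dyE j c : (y j)^`M(c) = (c == j)%:R + (r j)^`M(c).
  by rewrite rE !mderivD mderivC add0r mderivXU.
have wr j c : weight_ge d (d j + h - d c) (r j)^`M(c).
  exact: weight_ge_mderiv (@yE j).
pose E1 := \sum_c (r a)^`M(c) * (r b)^`M(rev_ord c).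
have wE1 : weight_ge d ((d a + d b - 2) + h) E1.
  apply: weight_ge_sum => c _; apply: weight_geW (weight_geM (@wr a c) (@wr b (rev_ord c))).
  by have := d_dual c; have := d_le c; have := d_le (rev_ord c);
     have := d_ge2 a; have := d_ge2 b; lia.
pose E0 := (r a)^`M(rev_ord b) + (r b)^`M(rev_ord a).
have wE0 : weight_ge d (d a + d b - 2) E0.
  apply: weight_geD.
    apply: weight_geW (@wr a (rev_ord b)).
    by have := d_dual b; lia.
  apply: weight_geW (@wr b (rev_ord a)).
  by have := d_dual a; lia.
exists (E0 + E1).
  (* Each derivative of y_j is a Kronecker delta plus a derivative of the remainder: the four
     products give the constant, the two terms of E0, and E1. *)
  transitivity (\sum_c (((c == a)%:R * (rev_ord c == b)%:R + (c == a)%:R * (r b)^`M(rev_ord c))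
      + ((rev_ord c == b)%:R * (r a)^`M(c) + (r a)^`M(c) * (r b)^`M(rev_ord c)))).
    by apply: eq_bigr => c _; rewrite !dyE; ring.
  rewrite !big_split /= -/E1 addrA -!addrA; congr (_ + _).
    rewrite (bigD1 a) //= eqxx mul1r big1 ?addr0 => [|c ca]; last by rewrite (negbTE ca) mul0r.
    by rewrite eq_sym mpolyC_nat.
  rewrite /E0 addrCA !addrA; congr (_ + _ + _).
    rewrite (bigD1 (rev_ord b)) //= rev_ordK eqxx mul1r big1 ?addr0 // => c cb.
    case: eqP => [e|_]; last by rewrite mul0r.
    by case/eqP: cb; rewrite -e rev_ordK.
  rewrite (bigD1 a) //= eqxx mul1r big1 ?addr0 // => c ca.
  by rewrite (negbTE ca) mul0r.
split=> [|m mw].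
  by apply: weight_geD => //; apply: weight_geW wE1; rewrite leq_addr.
(* Derivatives of y and of r differ by constants, invisible at m since its weight is positive. *)
have w_gt0 : (0 < d a + d b - 2)%N by have := d_ge2 a; have := d_ge2 b; lia.
have m_neq0 : (m == 0%MM) = false.
  by apply/eqP => m0; move: w_gt0; rewrite -mw m0 wdeg0.
rewrite mcoeffD [E1@_m]wE1 ?addr0; last by have := d_ge2 a; have := d_le a; lia.
rewrite !dyE !mcoeffD.
have nat0 (e : bool) : (e%:R : {mpoly K[n]})@_m = 0.
  by rewrite -mpolyC_nat mcoeffC m_neq0 mulr0.
by rewrite !nat0 !add0r.
Qed.

End LeadingTerms.

(** * Assembly: duality of degrees, expansion of good invariants, comparison of weights *)

Theorem theorem7p5 (R : realType) (gT : finGroupType) (G : {group gT})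
    (n : nat) (rG : mx_representation R[i] G n.+1)
    (VR : 'rV[R[i]]_n.+1 -> Prop) (I : 'M[R[i]]_n.+1)
    (d : 'I_n.+1 -> nat) (g : gT) (zeta : R[i]) (q : 'rV[R[i]]_n.+1)
    (z x : n.+1.-tuple {mpoly R[i][n.+1]})
    (hG : irreducible_real_reflection_group rG VR)
    (hG1 : G :!=: 1%g)
    (hI : extends_invariant_inner_product rG VR I)
    (hadm : admissible_triplet rG d g zeta q)
    (hz : homogeneous_basis rG d g zeta z)
    (hIz : forall a b : 'I_n.+1,
       dual_bform I (tnth z a) (tnth z b) = (b == rev_ord a)%:R)
    (hx : basic_invariants rG d x)
    (hgood : good d z x q)
    (hcomp : compatible z x q) :
  [/\ (tnth x ord_max).@[q 0] != 0,
      forall a b : 'I_n.+1,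
        IG_diff I z (tnth x a) (tnth x b) =
          (b == rev_ord a)%:R *:
            (((tnth x ord_max).@[q 0])^-1 *: tnth x ord_max)
          + \sum_(m : 'X_{1..n.+1 < (d a + d b).+1} |
                   (m ord_max == 0%N) && (wdeg d m == d a + d b - 2)%N)
              ((mfact m)%:R^-1 *
               (pderiv z m (pderiv z U_(rev_ord b) (tnth x a)
                            + pderiv z U_(rev_ord a) (tnth x b))).@[q 0])
                *: mpow x m
    & forall (a b : 'I_n.+1) (m : 'X_{1..n.+1}),
        m ord_max = 0%N -> wdeg d m = (d a + d b - 2)%N ->
        pderiv z m (pderiv z U_(rev_ord b) (tnth x a))
          = pderiv z (m + U_(rev_ord b))%MM (tnth x a)
        /\ wdeg d (m + U_(rev_ord b))%MM = (d a + d ord_max)%N].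
Proof.
have [faith gen realV irr] := hG.
have [gG [q_neq0 qg] zprim _] := hadm.
have [zb zeig] := hz; have [inv_x free_x gen_x mono_d] := hx.
set h := d ord_max in zprim.
have d_ge2 j : (1 < d j)%N.
  have := degree_neq0 hx j; have := degree_neq1 irr hx j faith hG1.
  by case: (d j) => [|[]].
have d_gt0 j : (0 < d j)%N by apply: ltnW.
have d_le j : (d j <= h)%N by apply: mono_d; rewrite -ltnS.
have zeta_neq0 : zeta != 0.
  apply/eqP => z0; have := prim_expr_order zprim.
  by rewrite z0 expr0n gtn_eqF ?d_gt0 // => /eqP; rewrite eq_sym oner_eq0.
have Iu := gram_unit hIz.
have Iinv e (eG : e \in G) := invariant_gram realV hI eG.
have d_dual j : (d j + d (rev_ord j) = h + 2)%N.
  have nz : dual_bform I (tnth z j) (tnth z (rev_ord j)) != 0.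
    by rewrite hIz eqxx oner_neq0.
  move/eqP: (dual_form_eigen gG hz Iu Iinv nz).
  rewrite -(prim_order_dvd zprim); apply: dual_degree.
    by rewrite d_ge2 d_le.
  by rewrite d_ge2 d_le.
(* If d_j = h with j != n, duality gives two distinct quadratic generators, of indices j* and n*. *)
have d_lt j : j != ord_max -> (d j < h)%N.
  move=> jmax; rewrite ltn_neqAle d_le andbT; apply: contraNneq jmax => dj.
  have d1 : d (rev_ord j) = 2%N by have := d_dual j; lia.
  have d2 : d (rev_ord ord_max) = 2%N by have := d_dual ord_max; rewrite -/h; lia.
  by apply/eqP/rev_ord_inj; apply: quadratic_invariant_unique irr hx _ _ d1 d2.
have only_max j e : zeta ^+ e = zeta ^+ d j -> (h %| e)%N -> j = ord_max.
  move=> ze /(dvdn_trans _) he; apply/eqP; apply: contraT => /d_lt.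
  have : (h %| d j)%N by rewrite (prim_order_dvd zprim) -ze -(prim_order_dvd zprim) he.
  by move=> /(dvdn_leq (d_gt0 j)); rewrite leqNgt => /negbTE ->.
pose k := (tnth x ord_max).@[q 0].
have zq j : j != ord_max -> (tnth z j).@[q 0] = 0.
  move=> jmax; apply: contraNeq jmax => /(meval_coord_eigen gG zeta_neq0 d_gt0 qg hz) e.
  by apply/eqP/(only_max _ 0%N); rewrite ?expr0.
(* Euler and compatibility give d_n x^n(q) = z^n(q). Were it zero, all z^j(q) would vanish and q
   would be 0. *)
have k_neq0 : k != 0.
  have [_ homx] := inv_x ord_max.
  have eul : (d ord_max)%:R * k = (tnth z ord_max).@[q 0].
    rewrite (euler_pderiv zb q homx) -(sum_mul_delta (fun j => (tnth z j).@[q 0])).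
    by apply: eq_bigr => j _; rewrite (hcomp ord_max j).
  apply: contraNneq q_neq0 => k0; apply/eqP.
  have zq0 j : (tnth z j).@[q 0] = 0.
    have [->|/zq //] := eqVneq j ord_max.
    by rewrite -eul k0 mulr0.
  apply: trmx_inj; rewrite trmx0; apply: (can_inj (mulKmx (coord_mx_unit zb))).
  rewrite mulmx0; apply/colP => j; rewrite [RHS]mxE -[RHS](zq0 j).
  rewrite [in RHS](coord_mxE zb) meval_sum mxE; apply: eq_bigr => l _.
  by rewrite mevalZ mevalXU; congr (_ * _); rewrite mxE.
have [y yj] : exists y : n.+1.-tuple {mpoly R[i][n.+1]},
    forall j, tnth y j = recenter z q (tnth x j).
  by exists [tuple recenter z q (tnth x j) | j < n.+1] => j; rewrite tnth_mktuple.
(* Below weight d_j + h only the constant and u_j survive. The cases are: m = 0, settled by the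
   congruence; m linear, by compatibility; weight d_j, by goodness; any other weight, by the
   congruence again. *)
have yE j : weight_ge d (d j + d ord_max)
    (tnth y j - (k *+ (j == ord_max))%:MP - 'X_j).
  move=> m mlt; rewrite yj !mcoeffB mcoeffC mcoeffX.
  have [inv_xj homx] := inv_x j.
  have eig := recenter_coef_eigen (m := m) gG zeta_neq0 d_gt0 qg hz inv_xj homx.
  have [m0|m0] := eqVneq m 0%MM.
    rewrite m0 mnm1_eq0 mulr1 subr0.
    have [->|jmax] := eqVneq j ord_max; first by rewrite mulr1n -meval_recenter subrr.
    rewrite mulr0n subr0; apply/eqP; apply: contraNT jmax; rewrite -m0 => /eig.
    by rewrite m0 wdeg0 => e; apply/eqP/(only_max _ 0%N).
  rewrite mulr0 subr0; have [[l mE]|m1] := altP (mdeg1P m).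
    rewrite (eqP mE); have := hcomp j l; rewrite meval_pderiv //.
    have -> : mfact U_(l)%MM = 1%N :> nat.
      rewrite /mfact big1 // => i _; rewrite mnm1E; by case: (l == i).
    rewrite mulr1n => ->; apply/eqP; rewrite subr_eq0; apply/eqP; congr (_%:R).
    case: (eqVneq j l) => [->|jl]; first by rewrite eqxx.
    case: eqP => // /mnmP/(_ l); rewrite !mnm1E eqxx; by rewrite (negbTE jl).
  have -> : (U_(j)%MM == m) = false.
    by apply/eqP => e; case/negP: m1; rewrite -e mdeg1.
  rewrite subr0; have [mw|mw] := eqVneq (wdeg d m) (d j).
    exact: (good_leading_linear zb d_gt0 free_x hgood).
  apply: contraNeq mw => /eig /eqP; rewrite (eq_prim_root_expr zprim) => /eqP wE.
  apply/eqP; apply: eqn_mod_window mlt (d_le j) wE.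
  by rewrite lt0n; apply: contraNneq m0 => /(wdeg_eq0 d_gt0) ->.
(* Duality turns d_a + d_b - 2 + d_{b*} into d_a + h, so the coefficients used have the announced
   weight. *)
have clause3 : forall (a b : 'I_n.+1) (m : 'X_{1..n.+1}),
    m ord_max = 0%N -> wdeg d m = (d a + d b - 2)%N ->
    pderiv z m (pderiv z U_(rev_ord b) (tnth x a))
      = pderiv z (m + U_(rev_ord b))%MM (tnth x a)
    /\ wdeg d (m + U_(rev_ord b))%MM = (d a + d ord_max)%N.
  move=> a b m _ mw; split; first exact: pderiv_add.
  rewrite wdegD wdegU mw -/h.
  by have := d_dual b; have := d_ge2 a; have := d_ge2 b; lia.
split=> // a b.
have [inva homa] := inv_x a; have [invb homb] := inv_x b.
(* The form is an invariant of degree d_a + d_b - 2, hence P(x) with P weighted homogeneous; P is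
   then read off from the recentred identity P(y) = delta + E. *)
have [p IGp] := gen_x _ (IG_diff_invariant zb Iu Iinv inva invb).
have := dhomog_IG_diff I zb homa homb; rewrite IGp => homp.
have [P PE wP] := dhomog_comp_lift (fun j => (inv_x j).2) homp.
have {}wP m : m \in msupp P -> wdeg d m = (d a + d b - 2)%N.
  by move=> /wP ->; rewrite predD2.
have [E EE [wE coefE]] := derivative_pairing d_le d_ge2 d_dual yE a b.
have PyE : P \mPo y = ((b == rev_ord a)%:R)%:MP + E.
  rewrite -EE -(recenter_comp_eq P yj) -PE -IGp (recenter_IG_diff q _ _ zb hIz).
  by apply: eq_bigr => c _; rewrite !yj.
have /andP[w_gt0 w_lt] : (0 < d a + d b - 2 < h + h)%N.
  by apply: weight_window; rewrite d_ge2 d_le.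
have delta_w : (b == rev_ord a)%:R != 0 :> R[i] -> (d a + d b - 2)%N = h.
  by case: (b =P rev_ord a) => [->|_]; [rewrite d_dual addnK | rewrite eqxx].
have wb : (d a + d b - 2 < (d a + d b).+1)%N by rewrite ltnS leq_subr.
rewrite PE; have -> := leading_terms_determine d_gt0 k_neq0 yE w_gt0 w_lt wP wE delta_w PyE wb.
rewrite comp_mpolyD comp_mpolyZ comp_mpoly_tnth scalerA; congr (_ + _).
rewrite raddf_sum; apply: eq_bigr => m /andP[_ /eqP mw] /=.
rewrite comp_mpolyZ comp_mpolyX taylor_coef // coefE //.
by rewrite (recenter_pderivUD _ _ _ _ _ zb) -(yj a) -(yj b).
Qed.
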